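(* Let $F$ be a continuous distribution function with $\operatorname{ess\,inf}F=0$. Then the compound Poisson distribution ${\rm CP}(\lambda,F)$ satisfies property (SD) for all $\lambda\in\mathbb R_{++}$ if and only if $F\in\mathcal H$.
   Context: $\mathbb R_+=[0,\infty)$ and $\mathbb R_{++}=(0,\infty)$. For a distribution function $F$, $\overline F=1-F$ and $\operatorname{ess\,inf}F$ denotes its essential infimum. Compound Poisson: ${\rm CP}(\lambda,F)$ is the distribution of $\sum_{i=1}^NY_i$ (an empty sum is $0$), where $Y_1,Y_2,\dots$ are iid with distribution function $F$ and $N$, independent of $(Y_i)_{i\ge1}$, is Poisson with mean $\lambda$. Inverted concave: a distribution function $F$ with $\operatorname{ess\,inf}F=0$ belongs to $\mathcal H$ if $x\mapsto\overline F(1/x)$ is concave on $\mathbb R_{++}$. Usual stochastic order: $X\le_{\rm st}Y$ means $\mathbb P(X\le x)\ge\mathbb P(Y\le x)$ for all $x\in\mathbb R$. Majorization order: for $\overline\theta,\overline\eta\in\mathbb R^n$, with $\theta_{(i)},\eta_{(i)}$ the $i$-th smallest coordinates, $\overline\theta\preceq\overline\eta$ means $\sum_{i=1}^k\theta_{(i)}\ge\sum_{i=1}^k\eta_{(i)}$ for all $k\in\{1,\dots,n\}$ and $\sum_{i=1}^n\theta_i=\sum_{i=1}^n\eta_i$. Property (SD): a distribution satisfies (SD) if for every integer $n\ge2$ and iid $X_1,\dots,X_n$ with that distribution, $\sum_{i=1}^n\eta_iX_i\le_{\rm st}\sum_{i=1}^n\theta_iX_i$ for all $\overline\theta,\overline\eta\in\mathbb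 R_+^n$ with $\overline\theta\preceq\overline\eta$. *)

(* Defs.v *)
From HB Require Import structures.
From mathcomp Require Import all_boot all_order all_algebra finmap.
From mathcomp Require Import all_classical all_reals all_analysis.
From mathcomp Require Import measurable_realfun ess_sup_inf.

Set Implicit Arguments.
Unset Strict Implicit.
Unset Printing Implicit Defensive.

Import Order.TTheory GRing.Theory Num.Theory.
Import numFieldNormedType.Exports.

Local Open Scope classical_set_scope.
Local Open Scope ring_scope.

Section distribution_functions.
Context {R : realType}.

(* A distribution function is a [cumulativeBounded 0 1]: nondecreasing, right
   continuous, with limits 0 at -oo and 1 at +oo.  Its law is the associated
   Lebesgue-Stieltjes probability measure, and its essential infimum is that of
   the identity under this law. *)
Definition df_ess_inf (F : cumulativeBounded (0 : R) (1 : R)) : \bar R :=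
  ess_inf (lebesgue_stieltjes_measure F) (fun x : R => x%:E).

Definition concave_function (D : set R) (f : R -> R) : Prop :=
  @convex_function R R^o D (fun x => - f x).

Definition inverted_concave (F : cumulativeBounded (0 : R) (1 : R)) : Prop :=
  df_ess_inf F = 0%E /\
  concave_function [set x | 0 < x] (fun x => 1 - F x^-1).

End distribution_functions.

Section independence.
Context d (T : measurableType d) (R : realType) (P : probability T R).
Local Open Scope ereal_scope.

Definition mutually_independent (I : choiceType) (X : I -> {RV P >-> R}) :
    Prop :=
  forall (J : {fset I}) (A : I -> set R), (forall i, measurable (A i)) ->
    P (\bigcap_(i in [set` J]) (X i @^-1` A i)) =
    \prod_(i <- J) P (X i @^-1` A i).

Definition sigma_family (I : Type) (X : I -> {RV P >-> R}) : set (set T) :=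
  <<s \bigcup_i preimage_set_system setT (X i) measurable >>.

Definition independent_of_family (I : Type) (N : {RV P >-> nat})
    (X : I -> {RV P >-> R}) : Prop :=
  forall (B : set nat) (E : set T), measurable B -> sigma_family X E ->
    P (N @^-1` B `&` E) = P (N @^-1` B) * P E.

End independence.

(* Laws are compared on Borel sets only, since measures are total functions
   whose values on nonmeasurable sets are meaningless. *)
Definition has_law d (T : measurableType d) (R : realType)
    (P : probability T R) (X : {RV P >-> R})
    (mu : probability R R) : Prop :=
  forall A : set R, measurable A -> distribution P X A = mu A.

Section random_sum.
Context d (T : measurableType d) (R : realType) (P : probability T R).
Variables (N : {RV P >-> nat}) (Y : nat -> {RV P >-> R}).

(* [Y i] is the (i+1)-st summand *)
Definition random_sum (w : T) : R := \sum_(i < N w) Y i w.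

Let measurable_random_sum : measurable_fun setT random_sum.
Proof.
move=> _ B mB; rewrite setTI.
have -> : random_sum @^-1` B = \bigcup_k
    (N @^-1` [set k] `&` (fun w => \sum_(i < k) Y i w) @^-1` B).
  apply/seteqP; split => [w Bw|w [k _ [/= Nk]]]; first by exists (N w).
  by rewrite /random_sum Nk.
apply: bigcupT_measurable => k; apply: measurableI.
  exact: measurable_funPTI.
have mS : measurable_fun setT (fun w => \sum_(i < k) Y i w).
  by apply: measurable_sum => i; exact: measurable_funPT.
by rewrite -[X in measurable X]setTI; exact: mS.
Qed.

HB.instance Definition _ :=
  isMeasurableFun.Build _ _ _ _ random_sum measurable_random_sum.

End random_sum.

(* mu is the law CP(lambda, F); it is determined by lambda and F up to its values
   on nonmeasurable sets, whatever the probability space carrying N and Y. *)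
Definition compound_poisson (R : realType) (lambda : R) (F : R -> R)
    (mu : probability R R) : Prop :=
  exists (d : measure_display) (T : measurableType d) (P : probability T R)
         (N : {RV P >-> nat}) (Y : nat -> {RV P >-> R}),
    [/\ forall k, P (N @^-1` [set k]) = (poisson_pmf lambda k)%:E,
        forall i x, cdf (Y i) x = (F x)%:E,
        mutually_independent Y,
        independent_of_family N Y &
        has_law (random_sum N Y : {RV P >-> R}) mu].

Section weighted_sum.
Context d (T : measurableType d) (R : realType) (P : probability T R).
Variables (n : nat) (theta : 'rV[R]_n) (X : 'I_n -> {RV P >-> R}).

Definition weighted_sum (w : T) : R := \sum_(i < n) theta 0 i * X i w.

Let measurable_weighted_sum : measurable_fun setT weighted_sum.
Proof.
apply: measurable_sum => i.
by apply: measurable_funM.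
Qed.

HB.instance Definition _ :=
  isMeasurableFun.Build _ _ _ _ weighted_sum measurable_weighted_sum.

End weighted_sum.

Definition st_le (R : realType) d (T : measurableType d) (P : probability T R)
    (X : {RV P >-> R}) d' (T' : measurableType d') (P' : probability T' R)
    (Y : {RV P' >-> R}) : Prop :=
  forall x : R, (cdf Y x <= cdf X x)%E.

(* the (i+1)-st smallest coordinate *)
Definition order_stat (R : realType) n (theta : 'rV[R]_n) (i : nat) : R :=
  (sort <=%R [seq theta 0 j | j : 'I_n])`_i.

Definition majorized (R : realType) n (theta eta : 'rV[R]_n) : Prop :=
  (forall k : nat, (1 <= k <= n)%N ->
     \sum_(i < k) order_stat eta i <= \sum_(i < k) order_stat theta i) /\
  \sum_i theta 0 i = \sum_i eta 0 i.

Definition SD (R : realType) (mu : probability R R) : Prop :=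
  forall n : nat, (2 <= n)%N ->
  forall (d : measure_display) (T : measurableType d) (P : probability T R)
    (X : 'I_n -> {RV P >-> R}),
  (forall i, has_law (X i) mu) -> mutually_independent X ->
  forall theta eta : 'rV[R]_n,
  (forall i, 0 <= theta 0 i) -> (forall i, 0 <= eta 0 i) ->
  majorized theta eta ->
  st_le (weighted_sum eta X : {RV P >-> R}) (weighted_sum theta X : {RV P >-> R}).

(* Main.v *)
Require Import Defs.
From HB Require Import structures.
From mathcomp Require Import all_boot all_order all_algebra finmap.
From mathcomp Require Import all_classical all_reals all_analysis.
From mathcomp Require Import measurable_realfun ess_sup_inf.
From mathcomp Require Import ring lra.

Set Implicit Arguments.
Unset Strict Implicit.
Unset Printing Implicit Defensive.

Import Order.TTheory GRing.Theory Num.Theory.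
Import numFieldNormedType.Exports.

Local Open Scope classical_set_scope.
Local Open Scope ring_scope.

(** Write Y for a variable with law F, tail(s, a) for P (a Y > s), and S_a for
    the operator sending a nonnegative measurable function f to
    x |-> E f(x + a Y). Operators of this kind stand for laws, composition for
    convolution: they commute by Tonelli, and a sum of independent variables
    acts as the composition of their operators
    ([expectation_linear_comb]).

    Conditioning on the Poisson variable, a CP(lambda, F) variable scaled by a
    acts as e^-lambda exp(lambda S_a) ([shift_compound_poisson]). Since
    exponentials of commuting operators multiply ([exp_operator_add]),
    theta_1 X_1 + ... + theta_n X_n acts as
    e^-(n lambda) exp(lambda (S_theta_1 + ... + S_theta_n)), so its
    distribution function at t is
    e^-(n lambda) sum_k lambda^k / k! M_theta^k H_t (0), where
    M_theta = S_theta_1 + ... + S_theta_n and H_t is the indicator of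
    ]-oo, t] ([cdf_weighted_sum]). This is the distribution function of a
    compound Poisson law of rate n lambda whose jumps follow the mixture of the
    laws of the theta_i Y. Moreover
    M_theta H_t (x) = n - sum_i tail(t - x, theta_i)
    ([mixture_heaviside]).

    If x |-> 1 - F(1/x) is concave, then every tail(s, .) is concave on
    [0, +oo[ ([concave_scaled_tail]), and Karamata's inequality ([karamata])
    turns a majorization of theta and eta into M_theta H_t <= M_eta H_t. The
    two mixtures commute and are positive, so the inequality passes to all
    powers ([iter_le]), hence to the exponential series: this is (SD).

    Conversely, apply (SD) to two independent copies and to
    theta = (m, m), eta = (a, b) with m the midpoint of a and b. Both series
    have the same term of order 0, so as lambda tends to 0 the terms of order 1
    compare: M_theta H_1 (0) <= M_eta H_1 (0) ([mixture_le_of_exp]). In terms of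
    G(u) = 1 - F(1/u) = tail(1, u), this says G(a) + G(b) <= 2 G(m). A
    continuous midpoint concave function is concave ([midpoint_concave]).

    The converse uses (SD) at every rate, so a compound Poisson law has to
    exist at every rate ([compound_poisson_exists]): an infinite independent
    sequence with law F is needed. The binary digits of a uniform variable are
    independent fair coins; splitting a sequence of coins into its even and odd
    positions produces two independent sequences with the same law, and
    splitting the odd part again and again produces infinitely many; each is
    read as a binary expansion and sent through the quantile function of F. *)

(** * Commuting positive operators and their exponentials *)
Section positive_operators.
Context {R : realType}.
Local Open Scope ereal_scope.
Implicit Types (f g : R -> \bar R) (U A B : (R -> \bar R) -> R -> \bar R).

Definition nnmeasurable f := measurable_fun setT f /\ forall x, 0 <= f x.

(** The properties of f |-> E f(. + Y) that the exponential calculus uses. They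
    are stable under sums, so that S_a + S_b, which is no longer the operator of
    a probability law, can be treated in the same way. *)
Record sigma_operator U : Prop := SigmaOperator {
  sop_nnmeasurable : forall f, nnmeasurable f -> nnmeasurable (U f);
  sop_le : forall f g, nnmeasurable f -> nnmeasurable g ->
    (forall x, f x <= g x) -> forall x, U f x <= U g x;
  sop_add : forall f g, nnmeasurable f -> nnmeasurable g ->
    U (f \+ g) = U f \+ U g;
  sop_scale : forall (c : R) f, (0 <= c)%R -> nnmeasurable f ->
    U (fun x => c%:E * f x) = fun x => c%:E * U f x;
  sop_series : forall f_ : nat -> R -> \bar R, (forall k, nnmeasurable (f_ k)) ->
    U (fun x => \sum_(k <oo) f_ k x) = fun x => \sum_(k <oo) U (f_ k) x }.

Definition commuting U A := forall f, nnmeasurable f -> U (A f) = A (U f).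

Definition opadd U A f := U f \+ A f.

Lemma nnmeasurable_ge0 f x : nnmeasurable f -> 0 <= f x.
Proof. by case. Qed.

Lemma nnmeasurableD f g :
  nnmeasurable f -> nnmeasurable g -> nnmeasurable (f \+ g).
Proof.
move=> [mf f0] [mg g0]; split; first exact: emeasurable_funD.
by move=> x; exact: adde_ge0.
Qed.

Lemma nnmeasurableZ (c : R) f :
  (0 <= c)%R -> nnmeasurable f -> nnmeasurable (fun x => c%:E * f x).
Proof.
move=> c0 [mf f0]; split; first exact: measurable_funeM.
by move=> x; rewrite mule_ge0.
Qed.

Lemma nnmeasurable_series (f_ : nat -> R -> \bar R) :
  (forall k, nnmeasurable (f_ k)) ->
  nnmeasurable (fun x => \sum_(k <oo) f_ k x).
Proof.
move=> h; split; last by move=> x; apply: nneseries_ge0 => k _ _; case: (h k).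
by apply: ge0_emeasurable_sum => k *; case: (h k).
Qed.

Lemma nnmeasurable_sum (I : Type) (r : seq I) (f_ : I -> R -> \bar R) :
  (forall i, nnmeasurable (f_ i)) ->
  nnmeasurable (fun x => \sum_(i <- r) f_ i x).
Proof.
move=> h; split; last by move=> x; apply: sume_ge0 => i _; case: (h i).
by apply: emeasurable_sum => i; case: (h i).
Qed.

Lemma nnmeasurable_iter U f k :
  sigma_operator U -> nnmeasurable f -> nnmeasurable (iter k U f).
Proof.
by move=> sU nf; elim: k => //= k ih; exact: sop_nnmeasurable.
Qed.

Lemma sop0 U : sigma_operator U -> U (fun=> 0) = (fun=> 0).
Proof.
move=> sU; rewrite -[in LHS](_ : (fun x : R => 0%:E * 0) = (fun=> 0)); last first.
  by apply/funext => x; rewrite mule0.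
by rewrite sop_scale//; apply/funext => x; rewrite mul0e.
Qed.

Lemma sop_sum U (I : Type) (r : seq I) (f_ : I -> R -> \bar R) :
  sigma_operator U -> (forall i, nnmeasurable (f_ i)) ->
  U (fun x => \sum_(i <- r) f_ i x) = fun x => \sum_(i <- r) U (f_ i) x.
Proof.
move=> sU h; elim: r => [|i r ih].
  under eq_fun do rewrite big_nil.
  by rewrite sop0//; apply/funext => x; rewrite big_nil.
under eq_fun do rewrite big_cons.
rewrite (_ : (fun x => _) = f_ i \+ (fun x => \sum_(j <- r) f_ j x))//.
rewrite sop_add ?ih//; last exact: nnmeasurable_sum.
by apply/funext => x; rewrite big_cons.
Qed.

Lemma sigma_operator_add U A :
  sigma_operator U -> sigma_operator A -> sigma_operator (opadd U A).
Proof.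
move=> sU sA; split.
- by move=> f nf; apply: nnmeasurableD; exact: sop_nnmeasurable.
- by move=> f g nf ng fg x; apply: leeD; exact: sop_le.
- move=> f g nf ng; rewrite /opadd !sop_add//; apply/funext => x /=.
  by rewrite addeACA.
- move=> c f c0 nf; rewrite /opadd !sop_scale//; apply/funext => x /=.
  by rewrite ge0_muleDr//; apply: nnmeasurable_ge0; exact: sop_nnmeasurable.
- move=> f_ nf; rewrite /opadd !sop_series//; apply/funext => x /=.
  by rewrite nneseriesD// => i _ _; apply: nnmeasurable_ge0;
     exact: sop_nnmeasurable.
Qed.

Lemma sigma_operator0 : sigma_operator (fun _ _ => 0).
Proof.
split=> //.
- by move=> *; apply/funext => x /=; rewrite adde0.
- by move=> *; apply/funext => x /=; rewrite mule0.
- by move=> *; apply/funext => x /=; rewrite eseries0.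
Qed.

Lemma sigma_operator_sum (I : Type) (r : seq I)
    (U_ : I -> (R -> \bar R) -> R -> \bar R) :
  (forall i : I, sigma_operator (U_ i)) ->
  sigma_operator (fun f x => \sum_(i <- r) U_ i f x).
Proof.
move=> sU; elim: r => [|i r ih].
  rewrite (_ : (fun f x => _) = (fun _ _ => 0)); first exact: sigma_operator0.
  by apply/funext => f; apply/funext => x; rewrite big_nil.
rewrite (_ : (fun f x => _) = opadd (U_ i) (fun f x => \sum_(j <- r) U_ j f x)).
  exact: sigma_operator_add.
by apply/funext => f; apply/funext => x; rewrite big_cons.
Qed.

Lemma commuting_sym U A : commuting U A -> commuting A U.
Proof. by move=> c f nf; rewrite c. Qed.

Lemma commuting_sum U (I : Type) (r : seq I)
    (A_ : I -> (R -> \bar R) -> R -> \bar R) : sigma_operator U ->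
  (forall i : I, sigma_operator (A_ i)) -> (forall i, commuting U (A_ i)) ->
  commuting U (fun f x => \sum_(i <- r) A_ i f x).
Proof.
move=> sU sA cUA f nf; rewrite sop_sum//; last first.
  by move=> i; exact: sop_nnmeasurable.
by apply/funext => x; apply: eq_bigr => i _; rewrite cUA.
Qed.

Lemma commuting_iter U A k f : sigma_operator A -> commuting U A ->
  nnmeasurable f -> U (iter k A f) = iter k A (U f).
Proof.
move=> sA c nf; elim: k => //= k ih.
by rewrite c ?ih//; exact: nnmeasurable_iter.
Qed.

Definition exp_coefficient (l : R) k : R := (l ^+ k / k`!%:R)%R.

Lemma exp_coefficient_ge0 l k : (0 <= l)%R -> (0 <= exp_coefficient l k)%R.
Proof. by move=> l0; rewrite divr_ge0// exprn_ge0. Qed.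

Lemma exp_coefficientS l k :
  (k.+1%:R * exp_coefficient l k.+1 = l * exp_coefficient l k)%R.
Proof.
have k0 : (k.+1%:R : R)%R != 0%R by rewrite pnatr_eq0.
rewrite /exp_coefficient factS natrM exprS invfM -mulrA mulrCA; congr (_ * _)%R.
by rewrite mulrCA mulVKf.
Qed.

(** The series of exp(l U), applied to f. *)
Definition exp_operator (l : R) U f x : \bar R :=
  \sum_(k <oo) (exp_coefficient l k)%:E * iter k U f x.

Lemma nnmeasurable_exp_term l U f k : (0 <= l)%R -> sigma_operator U ->
  nnmeasurable f -> nnmeasurable (fun x => (exp_coefficient l k)%:E * iter k U f x).
Proof.
move=> l0 sU nf; apply: nnmeasurableZ; last exact: nnmeasurable_iter.
exact: exp_coefficient_ge0.
Qed.

Lemma nnmeasurable_exp l U f : (0 <= l)%R -> sigma_operator U ->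
  nnmeasurable f -> nnmeasurable (exp_operator l U f).
Proof.
by move=> l0 sU nf; apply: nnmeasurable_series => k; exact: nnmeasurable_exp_term.
Qed.

Section exponential_law.
Variables (l : R) (U A : (R -> \bar R) -> R -> \bar R) (f : R -> \bar R).
Hypotheses (l0 : (0 <= l)%R) (sU : sigma_operator U) (sA : sigma_operator A).
Hypotheses (cUA : commuting U A) (nf : nnmeasurable f).

Let b i j x := (exp_coefficient l i * exp_coefficient l j)%:E *
  iter i U (iter j A f) x.

Let nUA i j : nnmeasurable (iter i U (iter j A f)).
Proof. by apply: nnmeasurable_iter => //; exact: nnmeasurable_iter. Qed.

Let nb i j : nnmeasurable (b i j).
Proof.
by apply: nnmeasurableZ; [rewrite mulr_ge0 ?exp_coefficient_ge0|
  exact: nUA].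
Qed.

Let Ub i j : (fun x => l%:E * U (b i j) x) =
  (fun x => i.+1%:R%:E * b i.+1 j x).
Proof.
rewrite /b sop_scale//; last by rewrite mulr_ge0// exp_coefficient_ge0.
apply/funext => x; rewrite !muleA -!EFinM; congr (_%:E * _).
by rewrite mulrA -exp_coefficientS -mulrA.
Qed.

Let Ab i j : (fun x => l%:E * A (b i j) x) =
  (fun x => j.+1%:R%:E * b i j.+1 x).
Proof.
rewrite /b sop_scale//; last by rewrite mulr_ge0// exp_coefficient_ge0.
rewrite (commuting_iter _ sU)//; last 2 first.
- exact: commuting_sym.
- exact: nnmeasurable_iter.
apply/funext => x; rewrite !muleA -!EFinM; congr (_%:E * _).
by rewrite mulrCA -exp_coefficientS mulrCA mulrA.
Qed.

(* Binomial formula for U + A, with the factorials absorbed in b: applying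
   l U (resp. l A) to b i j gives i + 1 (resp. j + 1) times a neighbouring b, so
   l (U + A) sends the sum of level m to m + 1 times that of level m + 1. *)
Let binomial m : (fun x => (exp_coefficient l m)%:E * iter m (opadd U A) f x) =
  (fun x => \sum_(i < m.+1) b i (m - i)%N x).
Proof.
elim: m => [|m ih].
  apply/funext => x; rewrite big_ord1 /b /=.
  by rewrite /exp_coefficient expr0 fact0 divr1 mulr1.
have sUA := sigma_operator_add sU sA.
apply/funext => x.
have m0 : (m.+1%:R : R) != 0%R by rewrite pnatr_eq0.
suff : m.+1%:R%:E * ((exp_coefficient l m.+1)%:E * iter m.+1 (opadd U A) f x) =
    m.+1%:R%:E * \sum_(i < m.+2) b i (m.+1 - i)%N x.
  move=> /(congr1 (fun z => (m.+1%:R^-1)%:E * z)).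
  by rewrite [in RHS]muleA [in LHS]muleA -!EFinM mulVf// !mul1e.
rewrite muleA -EFinM exp_coefficientS EFinM -muleA.
transitivity (l%:E * opadd U A
    (fun x => (exp_coefficient l m)%:E * iter m (opadd U A) f x) x).
  by rewrite (sop_scale sUA) ?exp_coefficient_ge0//; exact: nnmeasurable_iter.
rewrite ih (sop_sum _ sUA); last by move=> i; exact: nb.
rewrite ge0_sume_distrr; last first.
  by move=> i _; apply: nnmeasurable_ge0; exact/(sop_nnmeasurable sUA)/nb.
transitivity (\sum_(i < m.+1) (i.+1%:R%:E * b i.+1 (m - i)%N x +
                               (m - i).+1%:R%:E * b i (m - i).+1 x)).
  apply: eq_bigr => i _; rewrite ge0_muleDr; last 2 first.
  - by apply: nnmeasurable_ge0; exact/(sop_nnmeasurable sU)/nb.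
  - by apply: nnmeasurable_ge0; exact/(sop_nnmeasurable sA)/nb.
  by rewrite -[l%:E * U _ x]/((fun x => l%:E * U (b i (m - i)%N) x) x) Ub
    -[l%:E * A _ x]/((fun x => l%:E * A (b i (m - i)%N) x) x) Ab.
rewrite big_split/=.
have -> : \sum_(i < m.+1) i.+1%:R%:E * b i.+1 (m - i)%N x =
    \sum_(i < m.+2) i%:R%:E * b i (m.+1 - i)%N x.
  by rewrite [RHS]big_ord_recl mul0e add0e; apply: eq_bigr => i _.
have -> : \sum_(i < m.+1) (m - i).+1%:R%:E * b i (m - i).+1 x =
    \sum_(i < m.+2) (m.+1 - i)%:R%:E * b i (m.+1 - i)%N x.
  rewrite [RHS]big_ord_recr/= subnn mul0e adde0; apply: eq_bigr => i _.
  by rewrite subSn// -ltnS.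
rewrite -big_split/= ge0_sume_distrr; last first.
  by move=> i _; exact/nnmeasurable_ge0/nb.
apply: eq_bigr => i _; rewrite -ge0_muleDl ?lee_fin// -EFinD -natrD subnKC//.
by rewrite -ltnS.
Qed.

(** exp (U + A) = exp U exp A: by the binomial formula both sides are the sum of
    all b i j, along the diagonals i + j = m or row by row. *)
Lemma exp_operator_add :
  exp_operator l (opadd U A) f = exp_operator l U (exp_operator l A f).
Proof.
apply/funext => x; rewrite /exp_operator.
under eq_eseriesr => m _.
  rewrite -[_ * _]/((fun x => (exp_coefficient l m)%:E * iter m (opadd U A) f x) x)
    binomial.
  over.
have b0 i j : 0 <= b i j x by exact/nnmeasurable_ge0/nb.
(* b reindexed by the diagonal m = i + j, extended by 0 below i *)
pose c i m := if (i <= m)%N then b i (m - i)%N x else 0.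
have c0 i m : 0 <= c i m by rewrite /c; case: ifP.
transitivity (\sum_(m <oo) \sum_(i <oo) c i m).
  apply: eq_eseriesr => m _.
  rewrite (nneseries_split 0 m.+1)// add0n [X in _ + X]eseries0 ?adde0; last first.
    by move=> i mi _; rewrite /c leqNgt mi.
  rewrite big_mkord; apply: eq_bigr => i _.
  by rewrite /c -ltnS ltn_ord.
rewrite nneseries_interchange//.
apply: eq_eseriesr => i _.
transitivity (\sum_(j <oo) b i j x).
  rewrite (nneseries_split 0 i)// add0n big_nat_cond big1 ?add0e; last first.
    by move=> m /andP[/andP[_ mi] _]; rewrite /c leqNgt mi.
  rewrite -nneseries_addn//; apply: eq_eseriesr => j _.
  by rewrite /c leq_addl addnK.
have -> : iter i U (fun x0 => \sum_(k <oo) (exp_coefficient l k)%:E * iter k A f x0)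
   = fun x => \sum_(k <oo) (exp_coefficient l k)%:E * iter i U (iter k A f) x.
  elim: i => //= i ->.
  rewrite sop_series//; last first.
    move=> k; apply: nnmeasurableZ; first exact: exp_coefficient_ge0.
    by exact: nUA.
  apply/funext => y; apply: eq_eseriesr => k _.
  by rewrite sop_scale ?exp_coefficient_ge0//; exact: nUA.
rewrite -nneseriesZl//; last first.
  move=> k _; rewrite mule_ge0 ?lee_fin ?exp_coefficient_ge0//.
  by apply: nnmeasurable_ge0; exact: nUA.
by apply: eq_eseriesr => j _; rewrite muleA -EFinM.
Qed.

End exponential_law.

Lemma exp_operator0 l f : nnmeasurable f -> exp_operator l (fun _ _ => 0) f = f.
Proof.
move=> nf; apply/funext => x; rewrite /exp_operator (nneseries_split 0 1).
  rewrite big_nat1 /= /exp_coefficient expr0 fact0 divr1 mul1e eseries0 ?adde0//.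
  by move=> [|k]//= _ _; rewrite mule0.
move=> [|k] _ /=; last by rewrite mule0.
by rewrite /exp_coefficient expr0 fact0 divr1 mul1e nnmeasurable_ge0.
Qed.

(** As A and B commute, B A^k f = A^k B f <= A^k A f: the factors B are
    exchanged for A one at a time, always on the given f, which is why no
    monotonicity of the intermediate functions A^k f is required. *)
Lemma iter_le A B f k : sigma_operator A -> sigma_operator B ->
  commuting A B -> nnmeasurable f -> (forall x, B f x <= A f x) ->
  forall x, iter k B f x <= iter k A f x.
Proof.
move=> sA sB cAB nf BA; elim: k => //= k ih x.
apply: (@le_trans _ _ (B (iter k A f) x)).
  by apply: sop_le => //; exact: nnmeasurable_iter.
rewrite (commuting_iter _ sA)//; last exact: commuting_sym.
rewrite -iterS iterSr; elim: k {ih} x => //= k ih x.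
by apply: sop_le => //; apply: nnmeasurable_iter => //; exact: sop_nnmeasurable.
Qed.

End positive_operators.

(** * Majorization and concave functions *)
Section majorization.
Context {R : realType}.

(** Summation by parts: the partial sums of d are nonnegative and the weights c
    decrease, so each partial sum may be handed over to the next, smaller,
    weight. The induction carries the current partial sum acc and a bound C of
    the weights to come. Where d vanishes the weight is arbitrary: for slopes,
    it is undefined there. *)
Lemma abel_summation n (d c : nat -> R) (acc C : R) : 0 <= acc ->
  (forall i, (i < n)%N -> d i != 0 -> c i <= C) ->
  (forall i j, (i < j < n)%N -> d i != 0 -> d j != 0 -> c j <= c i) ->
  (forall k, (k <= n)%N -> 0 <= acc + \sum_(i < k) d i) ->
  acc + \sum_(i < n) d i = 0 ->
  0 <= C * acc + \sum_(i < n) c i * d i.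
Proof.
elim: n d c acc C => [|n ih] d c acc C acc0 cC cmono psum tot.
  by move: tot; rewrite !big_ord0 !addr0 => ->; rewrite mulr0.
have psum1 k : (k <= n)%N ->
    0 <= acc + d 0%N + \sum_(i < k) d i.+1.
  by move=> kn; have := psum k.+1 kn; rewrite big_ord_recl addrA.
have tot1 : acc + d 0%N + \sum_(i < n) d i.+1 = 0.
  by rewrite -[RHS]tot big_ord_recl addrA.
have mono1 i j : (i < j < n)%N -> d i.+1 != 0 -> d j.+1 != 0 ->
    c j.+1 <= c i.+1 by move=> ijn; exact: cmono.
rewrite big_ord_recl /=.
have [d0|d0] := eqVneq (d 0%N) 0.
  rewrite d0 mulr0 add0r.
  apply: (ih (d \o S) (c \o S)) => //=.
  - by move=> i ?; exact: cC.
  - by move=> k kn; have := psum1 k kn; rewrite d0 addr0.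
  - by rewrite -[RHS]tot1 d0 addr0.
have acc1 : 0 <= acc + d 0%N by have := psum1 0%N isT; rewrite big_ord0 addr0.
apply: (@le_trans _ _ (c 0%N * (acc + d 0%N) + \sum_(i < n) c i.+1 * d i.+1)).
  apply: (ih (d \o S) (c \o S)) => //= i ni di.
  exact: cmono.
rewrite addrA lerD2r mulrDr lerD2r ler_wpM2r//.
exact: cC.
Qed.

(** Concavity on [0, +oo[ as decrease of slopes, with denominators cleared. A
    jump at 0 is allowed: it occurs for a |-> P (a Y > 0). *)
Definition concave_nneg (h : R -> R) := forall a b c, 0 <= a -> a < b -> b < c ->
  (h c - h b) * (b - a) <= (h b - h a) * (c - b).

Let slope (h : R -> R) a b := (h b - h a) / (b - a).

Let slope_sym h a b : slope h a b = slope h b a.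
Proof. by rewrite /slope -(opprB (h a)) -(opprB a) invrN mulrNN. Qed.

Let slope_antil h a b c : concave_nneg h -> 0 <= a -> a < b -> b <= c ->
  slope h a c <= slope h a b.
Proof.
move=> ch a0 ab; rewrite le_eqVlt => /predU1P[->//|bc].
have := ch a b c a0 ab bc.
rewrite /slope ler_pdivrMr ?subr_gt0 ?(lt_trans ab)//.
rewrite mulrAC ler_pdivlMr ?subr_gt0//.
nra.
Qed.

Let slope_antir h a b c : concave_nneg h -> 0 <= a -> a <= b -> b < c ->
  slope h b c <= slope h a c.
Proof.
move=> ch a0; rewrite le_eqVlt => /predU1P[->//|ab] bc.
have := ch a b c a0 ab bc.
rewrite /slope ler_pdivrMr ?subr_gt0//.
rewrite mulrAC ler_pdivlMr ?subr_gt0 ?(lt_trans ab)//.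
nra.
Qed.

(* Slopes decrease when both endpoints increase; endpoints come in either order
   since the coordinates of theta and eta are not ordered with each other. *)
Let slope_anti h p q p' q' : concave_nneg h -> 0 <= p -> 0 <= q ->
  p <= p' -> q <= q' -> p != q -> p' != q' -> slope h p' q' <= slope h p q.
Proof.
move=> ch.
have key a b a' b' : 0 <= a -> a <= a' -> b <= b' -> a < b -> a' < b' ->
    slope h a' b' <= slope h a b.
  move=> a0 aa' bb' ab ab'.
  apply: (le_trans (slope_antir ch a0 aa' ab')).
  exact: slope_antil.
move=> p0 q0 pp' qq' pq pq'.
wlog ltpq : p q p' q' p0 q0 pp' qq' pq pq' / p < q => [wl|].
  case: (ltgtP p q) pq => // pq _; first by apply: wl => //; rewrite lt_eqF.
  by rewrite slope_sym (slope_sym _ p); apply: wl => //;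
    [rewrite lt_eqF|rewrite eq_sym].
case: (ltgtP p' q') pq' => // ltpq' _; first exact: key.
rewrite slope_sym.
have [qp'|p'q] := leP q q'; last by rewrite ltNge qq' in p'q.
apply: key => //; lra.
Qed.

Lemma sum_order_stat n (theta : 'rV[R]_n) (h : R -> R) :
  \sum_(i < n) h (order_stat theta i) = \sum_(i < n) h (theta 0 i).
Proof.
set s := [seq theta 0 j | j : 'I_n].
have ss : size (sort <=%R s) = n by rewrite size_sort size_map size_enum_ord.
transitivity (\sum_(x <- sort <=%R s) h x).
  by rewrite (big_nth 0) ss big_mkord.
rewrite (perm_big s); last by rewrite perm_sort.
by rewrite big_map big_enum.
Qed.

Lemma order_stat_le n (theta : 'rV[R]_n) i j : (i <= j < n)%N ->
  order_stat theta i <= order_stat theta j.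
Proof.
move=> /andP[ij jn]; apply: (sorted_leq_nth le_trans lexx) => //.
- by apply: sort_sorted; exact: le_total.
- by rewrite inE size_sort size_map size_enum_ord (leq_ltn_trans ij).
- by rewrite inE size_sort size_map size_enum_ord.
Qed.

Lemma order_stat_ge0 n (theta : 'rV[R]_n) i : (forall j, 0 <= theta 0 j) ->
  0 <= order_stat theta i.
Proof.
move=> t0; have [ni|ni] := leqP n i.
  by rewrite /order_stat nth_default// size_sort size_map size_enum_ord.
have : order_stat theta i \in sort <=%R [seq theta 0 j | j : 'I_n].
  by rewrite mem_nth// size_sort size_map size_enum_ord.
by rewrite mem_sort => /mapP[j _ ->].
Qed.

(** Karamata's inequality. With both vectors sorted, h (theta_i) - h (eta_i) is a
    slope of h times theta_i - eta_i; the slopes decrease with i by concavity,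
    and majorization says that the partial sums of theta_i - eta_i are
    nonnegative with total 0. *)
Lemma karamata n (theta eta : 'rV[R]_n) (h : R -> R) :
  concave_nneg h -> (forall i, 0 <= theta 0 i) -> (forall i, 0 <= eta 0 i) ->
  majorized theta eta ->
  \sum_(i < n) h (eta 0 i) <= \sum_(i < n) h (theta 0 i).
Proof.
move=> ch t0 e0 [psum tot].
rewrite -!sum_order_stat -subr_ge0 -sumrB.
pose d i := order_stat theta i - order_stat eta i.
pose c i := slope h (order_stat theta i) (order_stat eta i).
have cd i : h (order_stat theta i) - h (order_stat eta i) = c i * d i.
  rewrite /c slope_sym /slope /d.
  have [->|ne] := eqVneq (order_stat theta i) (order_stat eta i).
    by rewrite !subrr mulr0.
  by rewrite divfK// subr_eq0.
under eq_bigr do rewrite cd.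
pose C := \sum_(i < n) `|c i|.
rewrite -[leRHS]add0r -[X in X + _](mulr0 C).
apply: abel_summation => //.
- move=> i ni _; rewrite /C (bigD1 (Ordinal ni))//=.
  by rewrite (le_trans (ler_norm _))// lerDl sumr_ge0.
- move=> i j ijn; rewrite !subr_eq0 => di dj.
  have ijn' : (i <= j < n)%N by case/andP: ijn => /ltnW -> ->.
  apply: slope_anti => //; try exact: order_stat_ge0; exact: order_stat_le.
- move=> k kn; rewrite add0r sumrB subr_ge0.
  case: k kn => [|k] kn; first by rewrite !big_ord0.
  exact: psum.
- by rewrite add0r sumrB (sum_order_stat _ id) (sum_order_stat _ id) tot subrr.
Qed.

End majorization.

(** * The shift operator of a law; a pi-lambda criterion for independence *)
Section shift_operator.
Context {R : realType}.
Local Open Scope ereal_scope.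
Implicit Types (f : R -> \bar R) (nu : probability R R).

(** E f(x + a Y) for Y with law nu. *)
Definition shift nu (a : R) f (x : R) : \bar R := \int[nu]_y f (x + a * y)%R.

Let measurable_affine2 (a : R) :
  measurable_fun setT (fun z : R * R => z.1 + a * z.2)%R.
Proof.
by apply: measurable_funD => //; apply: measurable_funM.
Qed.

Lemma measurable_shifted f (a x : R) : measurable_fun setT f ->
  measurable_fun setT (fun y => f (x + a * y)%R).
Proof.
move=> mf; apply: (measurableT_comp mf).
by apply: measurable_funD => //; apply: measurable_funM.
Qed.

Lemma sigma_operator_shift nu a : sigma_operator (shift nu a).
Proof.
split.
- move=> f [mf f0]; split.
    apply: (measurable_fun_fubini_tonelli_F (m2 := nu)
      (fun z : R * R => f (z.1 + a * z.2)%R)) => //.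
    exact: (measurableT_comp mf).
  by move=> x; exact: integral_ge0.
- move=> f g [mf f0] [mg g0] fg x.
  by apply: ge0_le_integral => //; exact: measurable_shifted.
- move=> f g [mf f0] [mg g0]; apply/funext => x; rewrite /shift/=.
  by rewrite ge0_integralD//; exact: measurable_shifted.
- move=> c f c0 [mf f0]; apply/funext => x; rewrite /shift/=.
  by rewrite ge0_integralZl//; exact: measurable_shifted.
- move=> f_ nf; apply/funext => x; rewrite /shift/=.
  rewrite integral_nneseries//.
  + by move=> k; apply: measurable_shifted; case: (nf k).
  + by move=> k y _; case: (nf k).
Qed.

Lemma commuting_shift nu nu' a b : commuting (shift nu a) (shift nu' b).
Proof.
move=> f [mf f0]; apply/funext => x; rewrite /shift.
rewrite (fubini_tonelli (fun z : R * R => f (x + a * z.1 + b * z.2)%R))//.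
  by apply: eq_integral => z _; apply: eq_integral => y _; rewrite addrAC.
apply: (measurableT_comp mf).
apply: measurable_funD; last exact: measurable_funM.
by apply: measurable_funD => //; exact: measurable_funM.
Qed.

End shift_operator.

Section independence.
Context d (T : measurableType d) (R : realType) (P : probability T R).
Local Open Scope ereal_scope.

(** The sets E such that Z^-1(E) is independent of C form a lambda-system, so a
    generating pi-system suffices. *)
Lemma independent_of_event_generated d' (T' : measurableType d') (Z : T -> T')
    (G : set (set T')) (C : set T) :
  measurable_fun setT Z -> measurable C ->
  @measurable _ T' = <<s G >> -> setI_closed G ->
  (forall E, G E -> P (Z @^-1` E `&` C) = P (Z @^-1` E) * P C) ->
  forall E, measurable E -> P (Z @^-1` E `&` C) = P (Z @^-1` E) * P C.
Proof.
move=> mZ mC mG GI GC E; rewrite mG.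
have mZE F : measurable F -> measurable (Z @^-1` F).
  by move=> mF; rewrite -[_ @^-1` _]setTI; exact: mZ.
move: E; apply: dynkin_induction => //.
- by rewrite preimage_setT setTI probability_setT mul1e.
- move=> S mS ZS.
  rewrite preimage_setC setIC -setDE measureD//; last 2 first.
  - exact: mZE.
  - by rewrite (le_lt_trans (probability_le1 _ _))// ltry.
  rewrite probability_setC; last exact: mZE.
  transitivity (P C - P (Z @^-1` S) * P C).
    by congr (_ - _); rewrite setIC; exact: ZS.
  have mulB (a b : \bar R) : a \is a fin_num -> b \is a fin_num ->
      b - a * b = (1 - a) * b.
    by move=> fa fb; rewrite muleBl ?mul1e// fin_num_adde_defr.
  by apply: mulB; apply: fin_num_measure => //; exact: mZE.
- move=> F mF tF ZF.
  have bigE (H : (set T)^nat) : (forall n, measurable (H n)) ->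
      trivIset setT H -> P (\bigcup_k H k) = \sum_(k <oo) P (H k).
    move=> mH tH; rewrite measure_bigcup//.
    by apply: eq_eseriesl => i; rewrite in_setT.
  have tZF : trivIset setT (fun k => Z @^-1` F k).
    by move=> i j _ _ [t [Fi Fj]]; apply: tF => //; exists (Z t).
  rewrite preimage_bigcup setI_bigcupl bigE; last 2 first.
  - by move=> k; apply: measurableI => //; exact: mZE.
  - exact: trivIset_setIr.
  rewrite bigE//; last by move=> k; exact: mZE.
  transitivity (\sum_(k <oo) ((fine (P C))%:E * P (Z @^-1` F k))).
    apply: eq_eseriesr => k _.
    by rewrite fineK ?fin_num_measure// muleC; exact: ZF.
  by rewrite nneseriesZl// fineK ?fin_num_measure// muleC.
Qed.

End independence.

(** * Sums of independent random variables *)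
Section independent_sums.
Context d (T : measurableType d) (R : realType) (P : probability T R).
Context (I : choiceType) (X : I -> {RV P >-> R}).
Local Open Scope ereal_scope.

Definition joint_event (J : seq I) (A : I -> set R) : set T :=
  \bigcap_(i in [set` J]) (X i @^-1` A i).

Lemma measurable_preimage_rv i (A : set R) :
  measurable A -> measurable (X i @^-1` A).
Proof. by move=> mA; rewrite -[_ @^-1` _]setTI; exact: measurable_funPT. Qed.

Lemma joint_event_cons i J A :
  joint_event (i :: J) A = X i @^-1` A i `&` joint_event J A.
Proof.
apply/seteqP; split=> [w h|w [h1 h2] j /=].
  split; first by apply: (h i) => /=; rewrite mem_head.
  by move=> j jJ; apply: (h j) => /=; rewrite inE jJ orbT.
by rewrite inE => /predU1P[->//|]; exact: h2.
Qed.

Lemma joint_event_nil A : joint_event [::] A = setT.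
Proof. by apply/seteqP; split. Qed.

Lemma measurable_joint_event J A :
  (forall i, measurable (A i)) -> measurable (joint_event J A).
Proof.
move=> mA; elim: J => [|i J ih]; first by rewrite joint_event_nil.
by rewrite joint_event_cons; apply: measurableI => //; exact: measurable_preimage_rv.
Qed.

Hypothesis indepX : mutually_independent X.

Lemma joint_event_prod J A : uniq J -> (forall i, measurable (A i)) ->
  P (joint_event J A) = \prod_(i <- J) P (X i @^-1` A i).
Proof.
move=> uJ mA; have := indepX [fset i in J]%fset mA.
rewrite (_ : [set` [fset i in J]%fset] = [set` J]); last first.
  by apply/seteqP; split=> i /=; rewrite !inE.
move=> ->; apply: perm_big; apply: uniq_perm => //.
by move=> i; rewrite !inE.
Qed.

Variable a : I -> R.

Definition linear_comb (s : seq I) (w : T) : R := (\sum_(i <- s) a i * X i w)%R.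

Lemma measurable_linear_comb s : measurable_fun setT (linear_comb s).
Proof.
by apply: measurable_sum => i; apply: measurable_funM => //; exact: measurable_funPT.
Qed.

Let measurable_pair i s :
  measurable_fun setT (fun w => (X i w, linear_comb s w)).
Proof. by apply: measurable_fun_pair => //; exact: measurable_linear_comb. Qed.

Let rectangles : set (set (R * R)) :=
  [set A `*` B | A in measurable & B in measurable].

Let rectanglesI : setI_closed rectangles.
Proof.
move=> _ _ [A1 mA1 [A2 mA2 <-]] [B1 mB1 [B2 mB2 <-]].
exists (A1 `&` B1); first exact: measurableI.
by exists (A2 `&` B2); [exact: measurableI|rewrite setXI].
Qed.

(** The sum over s is independent of the variables outside s. The induction on s
    needs the joint events over J: adding X i to the sum uses the independence
    of the shorter sum from joint events that contain X i. *)
Lemma linear_comb_independent s J A B : uniq (s ++ J) ->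
  (forall i, measurable (A i)) -> measurable B ->
  P (linear_comb s @^-1` B `&` joint_event J A) =
  P (linear_comb s @^-1` B) * P (joint_event J A).
Proof.
elim: s J A B => [|i s ih] J A B.
  move=> _ mA mB.
  have -> : linear_comb [::] = cst 0%R.
    by apply/funext => w; rewrite /linear_comb big_nil.
  rewrite preimage_cst; case: ifPn => _; first by rewrite setTI probability_setT mul1e.
  by rewrite set0I measure0 mul0e.
move=> usJ mA mB.
have [uJ iJ] : uniq J /\ i \notin J.
  move: usJ; rewrite /= mem_cat negb_or cat_uniq => /andP[/andP[_ ->] /and3P[_ _ ->]].
  by [].
pose S := linear_comb s.
pose E := (fun z : R * R => a i * z.1 + z.2)%R @^-1` B.
have mE : measurable E.
  rewrite -[E]setTI; apply: (_ : measurable_fun setT _) => //.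
  by apply: measurable_funD => //; exact: measurable_funM.
have -> : linear_comb (i :: s) @^-1` B = (fun w => (X i w, S w)) @^-1` E.
  apply/seteqP; split => w; rewrite /preimage /E /S /linear_comb /= big_cons//.
apply: (independent_of_event_generated (G := rectangles)) => //.
- exact: measurable_pair.
- exact: measurable_joint_event.
- exact: measurable_prod_measurableType.
move=> _ [A0 mA0 [B0 mB0 <-]].
have key K : uniq K -> i \notin K -> uniq (s ++ i :: K) ->
    P ((fun w => (X i w, S w)) @^-1` (A0 `*` B0) `&` joint_event K A) =
    P (S @^-1` B0) * P (X i @^-1` A0) * P (joint_event K A).
  move=> uK iK usK.
  pose A' j := if j == i then A0 else A j.
  have mA' j : measurable (A' j) by rewrite /A'; case: ifP.
  have CK : joint_event K A = joint_event K A'.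
    apply: eq_bigcapr => j /= jK; rewrite /A'; case: eqVneq => // ji.
    by rewrite -ji jK in iK.
  transitivity (P (S @^-1` B0 `&` joint_event (i :: K) A')).
    rewrite joint_event_cons -CK setIA; congr (P (_ `&` _)).
    by apply/seteqP; split=> w /=; rewrite /A' eqxx => -[].
  rewrite ih// joint_event_prod//=; last by rewrite iK.
  rewrite big_cons -joint_event_prod// -CK muleA.
  by rewrite {1}/A' eqxx.
have usJ' : uniq (s ++ i :: J) by rewrite -cat1s uniq_catCA.
have us : uniq (s ++ [:: i]).
  by move: usJ'; rewrite -cat1s catA cat_uniq => /and3P[].
rewrite key//; congr (_ * _).
have := key [::] isT isT us.
by rewrite joint_event_nil setIT probability_setT mule1 => ->.
Qed.

(** A term and the sum of the following ones are independent, so their joint law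
    is a product measure and the expectation splits by Tonelli. *)
Lemma expectation_linear_comb s (f : R -> \bar R) x : uniq s ->
  nnmeasurable f ->
  \int[P]_w f (x + linear_comb s w)%R =
  foldr (fun i g => shift (distribution P (X i)) (a i) g) f s x.
Proof.
move=> + nf; elim: s x => [|i s ih] x us.
  rewrite /linear_comb.
  under eq_integral do rewrite big_nil addr0.
  by rewrite integral_cst//= probability_setT mule1.
have [mf f0] := nf.
have [iis us'] := andP us.
pose S : {RV P >-> R} := HB.pack (linear_comb s)
  (isMeasurableFun.Build _ _ _ _ _ (measurable_linear_comb s)).
pose Z w := (X i w, S w).
have mZ : measurable_fun setT Z by exact: measurable_pair.
have jointE E : measurable E ->
    (distribution P (X i) \x distribution P S) E = pushforward P Z E.
  move: E; apply: product_measure_unique => A B mA mB.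
  have usi : uniq (s ++ [:: i]) by rewrite cats1 rcons_uniq.
  have := linear_comb_independent usi (fun=> mA) mB.
  rewrite joint_event_cons joint_event_nil setIT muleC setIC => <-.
  by congr (P _); apply/seteqP; split.
pose g z := f (x + (a i * z.1 + z.2))%R.
have mg : measurable_fun setT g.
  apply: (measurableT_comp mf); apply: measurable_funD => //.
  by apply: measurable_funD => //; exact: measurable_funM.
transitivity (\int[P]_w g (Z w)).
  apply: eq_integral => w _; rewrite /g /=; congr f.
  by rewrite /linear_comb big_cons.
transitivity (\int[distribution P (X i) \x distribution P S]_z g z).
  rewrite (eq_measure_integral (pushforward P Z)); last first.
    by move=> A mA _; exact: jointE.
  by rewrite ge0_integral_pushforward// => z _; exact: f0.
rewrite fubini_tonelli1//; last by move=> z; exact: f0.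
rewrite /= {1}/shift; apply: eq_integral => u _.
rewrite -ih// /fubini_F ge0_integral_distribution//.
- by apply: eq_integral => w _; rewrite /g /= addrA.
- by apply: (measurableT_comp mg); exact: measurable_fun_pair.
- by move=> y; exact: f0.
Qed.

End independent_sums.

(** * Compound Poisson laws as exponentials *)
Section compound_poisson_law.
Context {R : realType}.
Local Open Scope ereal_scope.

Definition lower_rays : set (set R) := [set `]-oo, x]%classic | x in [set: R]].

Lemma measurable_lower_rays : @measurable _ R = <<s lower_rays >>.
Proof.
apply: (etrans (RGenOInfty.measurableE R)); apply/seteqP; split.
+ apply: smallest_sub; first exact: smallest_sigma_algebra.
  move=> _ [x ->]; rewrite -setCitvl; apply: sigma_algebraC.
  by apply: sub_sigma_algebra; exists x.
+ apply: smallest_sub; first exact: smallest_sigma_algebra.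
  move=> _ [x _ <-]; rewrite -setCitvr; apply: sigma_algebraC.
  by apply: sub_sigma_algebra; exists x.
Qed.

Lemma lower_raysI : setI_closed lower_rays.
Proof.
move=> _ _ [x _ <-] [y _ <-]; exists (Num.min x y) => //.
apply/seteqP; split=> z /=; rewrite !in_itv/= le_min.
  by move=> /andP[].
by case=> -> ->.
Qed.

Lemma probability_unique_cdf (m1 m2 : probability R R) :
  (forall x : R, m1 `]-oo, x]%classic = m2 `]-oo, x]%classic) ->
  forall A, measurable A -> m1 A = m2 A.
Proof.
move=> m12; apply: (measure_unique lower_rays (fun n => `]-oo, n%:R]%classic)).
- exact: measurable_lower_rays.
- exact: lower_raysI.
- by move=> n; exists n%:R.
- apply/seteqP; split => // x _.
  exists (Num.truncn `|x|).+1 => //=; rewrite in_itv/=.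
  by rewrite (le_trans (ler_norm _))// ltW// truncnS_gt.
- by move=> _ [x _ <-]; exact: m12.
- by move=> k; rewrite (le_lt_trans (probability_le1 _ _))// ltry.
Qed.

Variable F : cumulativeBounded (0 : R)%R (1 : R)%R.

Let idTR : measurableTypeR R -> R := idfun.

#[local] HB.instance Definition _ :=
  @isMeasurableFun.Build _ _ _ _ idTR (@measurable_id _ _ setT).

Definition df_law : probability R R :=
  distribution (lebesgue_stieltjes_measure F) idTR.

Lemma df_law_cdf x : df_law `]-oo, x]%classic = (F x)%:E.
Proof. exact: cdf_lebesgue_stieltjes_id. Qed.

Variables (d : measure_display) (T : measurableType d) (P : probability T R).

Lemma shift_distribution_df (Y : {RV P >-> R}) a f :
  (forall x, cdf Y x = (F x)%:E) ->
  shift (distribution P Y) a f = shift df_law a f.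
Proof.
move=> YF; apply/funext => x; apply: eq_measure_integral => A mA _.
by apply: probability_unique_cdf => // y; rewrite df_law_cdf -YF.
Qed.

Variables (N : {RV P >-> nat}) (Y : nat -> {RV P >-> R}).

(** Partial sums are measurable for the sigma-algebra of the family Y alone,
    which is what their independence of N requires. *)
Lemma sigma_family_sum s B : measurable B ->
  sigma_family Y (linear_comb Y (fun=> 1%R) s @^-1` B).
Proof.
move=> mB.
pose G := \bigcup_i preimage_set_system setT (Y i) measurable.
have mY i : measurable_fun (setT : set (g_sigma_algebraType G)) (Y i).
  move=> _ A mA; rewrite setTI; apply: sub_sigma_algebra.
  by exists i => //; exists A => //; rewrite setTI.
have mS : measurable_fun (setT : set (g_sigma_algebraType G))
    (fun w => \sum_(i <- s) 1 * Y i w)%R.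
  by apply: measurable_sum => i; apply: measurable_funM.
by rewrite -[_ @^-1` _]setTI; exact: mS.
Qed.

(** Conditioning on N: the law of the random sum is the series of the laws of
    the sums of k terms, weighted by P (N = k), and a sum of k terms acts as the
    k-th power of the operator of one term. *)
Lemma shift_compound_poisson (lambda : R) (mu : probability R R) a f :
  (0 < lambda)%R -> (forall k, P (N @^-1` [set k]) = (poisson_pmf lambda k)%:E) ->
  (forall i x, cdf (Y i) x = (F x)%:E) ->
  mutually_independent Y -> independent_of_family N Y ->
  has_law (random_sum N Y : {RV P >-> R}) mu ->
  nnmeasurable f ->
  shift mu a f = fun x =>
    (expR (- lambda))%:E * exp_operator lambda (shift df_law a) f x.
Proof.
move=> l0 NP YF iY iNY Smu nf; apply/funext => x.
pose S k : {RV P >-> R} := HB.pack (linear_comb Y (fun=> 1%R) (iota 0 k))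
  (isMeasurableFun.Build _ _ _ _ _
    (measurable_linear_comb Y (fun=> 1%R) (iota 0 k))).
pose p k : {nonneg R} := NngNum (poisson_pmf_ge0 lambda k).
pose m k : {measure set R -> \bar R} := mscale (p k) (distribution P (S k)).
have muE A : measurable A -> mu A = mseries m 0 A.
  move=> mA; rewrite -Smu// /mseries /distribution /pushforward.
  rewrite (_ : _ @^-1` A = \bigcup_k (N @^-1` [set k] `&` S k @^-1` A)); last first.
    have SE w k : linear_comb Y (fun=> 1%R) (iota 0 k) w = (\sum_(i < k) Y i w)%R.
      rewrite /linear_comb -(big_mkord xpredT (fun i => Y i w)) /index_iota subn0.
      by apply: eq_bigr => i _; rewrite mul1r.
    apply/seteqP; split => w /=.
      by move=> Aw; exists (N w) => //; split => //; rewrite /preimage /= SE.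
    by move=> [k _ [Nk]]; rewrite /preimage /= SE /random_sum Nk.
  rewrite measure_bigcup//.
  - transitivity (\sum_(k <oo) P (N @^-1` [set k] `&` S k @^-1` A)).
      by apply: eq_eseriesl => i; rewrite in_setT.
    apply: eq_eseriesr => k _.
    rewrite iNY//; last exact: sigma_family_sum.
    by rewrite NP.
  - move=> k _; apply: measurableI.
      by rewrite -[_ @^-1` _]setTI; exact: measurable_funPT.
    by rewrite -[_ @^-1` _]setTI; exact: measurable_funPT.
  - by move=> i j _ _ [w [[/= <- _] [/= <- _]]].
have [mf f0] := nf.
have mfx : measurable_fun setT (fun y => f (x + a * y)%R) by exact: measurable_shifted.
rewrite {1}/shift (eq_measure_integral (mseries m 0)); last first.
  by move=> A mA _; exact: muE.
rewrite ge0_integral_measure_series//.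
rewrite /exp_operator -nneseriesZl; last first.
  move=> k _; rewrite mule_ge0//.
    by rewrite lee_fin exp_coefficient_ge0// ltW.
  apply: nnmeasurable_ge0; apply: nnmeasurable_iter => //.
  exact: sigma_operator_shift.
apply: eq_eseriesr => k _.
rewrite ge0_integral_mscale//= muleA -EFinM.
congr (_%:E * _).
  by rewrite /poisson_pmf l0 mulrC /exp_coefficient.
rewrite ge0_integral_distribution//.
have <- : foldr (fun i g => shift (distribution P (Y i)) a g) f (iota 0 k) =
    iter k (shift df_law a) f.
  elim: k 0%N => //= k ih n.
  by rewrite ih shift_distribution_df.
rewrite -(expectation_linear_comb iY (fun=> a))//; last exact: iota_uniq.
apply: eq_integral => w _ /=; congr (f (_ + _)%R).
rewrite /linear_comb mulr_sumr; apply: eq_bigr => i _.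
by rewrite mul1r.
Qed.

End compound_poisson_law.

(** * Concavity of scaled tails *)
Section df_facts.
Context {R : realType}.
Variable F : cumulativeBounded (0 : R) (1 : R).

Lemma df_ge0 x : 0 <= F x.
Proof. by rewrite -lee_fin -df_law_cdf. Qed.

Lemma df_le1 x : F x <= 1.
Proof. by rewrite -lee_fin -df_law_cdf probability_le1. Qed.

Hypothesis Finf : df_ess_inf F = 0%E.

(** By [ess_infP], almost every point is at least 0 for the law of F. *)
Lemma df_neg x : x < 0 -> F x = 0.
Proof.
move=> x0; apply/EFin_inj; rewrite -df_law_cdf.
have : (0 <= df_ess_inf F)%E by rewrite Finf.
move=> /ess_infP neg0.
have mI : measurable (`]-oo, x]%classic : set R) by exact: measurable_itv.
apply: (measure_negligible (mu := lebesgue_stieltjes_measure F) mI).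
apply: negligibleS neg0 => y /=; rewrite in_itv/= lee_fin => yx.
by apply/negP; rewrite -ltNge (le_lt_trans yx).
Qed.

Hypothesis Fcont : continuous (F : R -> R).

Lemma df0 : F 0 = 0.
Proof.
apply/eqP; rewrite eq_le df_ge0 andbT leNgt; apply/negP => F0.
have Fc : F x @[x --> (0 : R)] --> F 0 by exact: Fcont.
have near0 : nbhs (0 : R) [set x | `|F 0 - F x| < F 0].
  exact: (@cvgr_dist_lt _ _ _ _ _ _ _ Fc _ F0).
have [e /= e0 he] := (nbhs_ballP _ _).1 near0.
have := he (- (e / 2)).
rewrite /ball /= sub0r opprK ger0_norm ?divr_ge0 ?ltW// (@df_neg (- (e / 2))); last first.
  by rewrite oppr_lt0 divr_gt0.
rewrite subr0 ger0_norm ?df_ge0// ltxx => h.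
suff : false by [].
by apply: h; rewrite ltr_pdivrMr// ltr_pMr// ltr1n.
Qed.

(** P (a Y > s) for a >= 0, where Y has law F; the variable a Y is 0 when
    a = 0. *)
Definition scaled_tail (s a : R) : R :=
  if a == 0 then (s < 0)%R%:R else 1 - F (s / a).

Definition heaviside (t x : R) : \bar R := (\1_(`]-oo, t]%classic : set R) x)%:E.

Lemma nnmeasurable_heaviside t : nnmeasurable (heaviside t).
Proof.
split; last by move=> x; rewrite lee_fin.
exact/measurable_EFinP/measurable_indic.
Qed.

Lemma shift_heaviside a t x : 0 <= a ->
  shift (df_law F) a (heaviside t) x = (1 - scaled_tail (t - x) a)%:E.
Proof.
move=> a0; rewrite /shift /scaled_tail /heaviside.
under eq_integral => y _ do rewrite indicE mem_setE in_itv/= -lerBrDl.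
have [->|an0] := eqVneq a 0.
  under eq_integral => y _ do rewrite mul0r.
  rewrite integral_cst//.
  rewrite [X in (_ * X)%E](_ : _ = 1%E); last exact: (probability_setT (df_law F)).
  rewrite mule1.
  by rewrite ltNge; case: (0 <= _); rewrite /= ?subr0 ?subrr.
have {an0}a0 : 0 < a by rewrite lt_neqAle eq_sym an0.
under eq_integral => y _ do rewrite mulrC -ler_pdivlMr//.
rewrite opprB addrCA subrr addr0 -df_law_cdf.
transitivity (\int[df_law F]_y (\1_(`]-oo, ((t - x) / a)%R]%classic : set R) y)%:E)%E.
  by apply: eq_integral => y _; rewrite indicE mem_setE in_itv.
by rewrite integral_indic// setIT.
Qed.

Let G u := 1 - F u^-1.

Lemma concave_functionP (D : set R) (g : R -> R) : concave_function D g <->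
  forall t x y, 0 <= t -> t <= 1 -> D x -> D y ->
    t * g x + (1 - t) * g y <= g (t * x + (1 - t) * y).
Proof.
split=> [cg t x y t0 t1 Dx Dy|cg t x y /set_mem Dx /set_mem Dy].
  have h : - g (t * x + (1 - t) * y) <= t * - g x + (1 - t) * - g y.
    exact: (cg (Itv01 t0 t1) x y (mem_set Dx) (mem_set Dy)).
  by move: h; rewrite !mulrN -opprD lerN2.
change (- g (t%:num * x + (1 - t%:num) * y) <=
  t%:num * - g x + (1 - t%:num) * - g y).
by rewrite !mulrN -opprD lerN2; apply: cg.
Qed.

Lemma concave_three_points a b c : concave_function [set x | 0 < x] G ->
  0 < a -> a < b -> b < c -> (G c - G b) * (b - a) <= (G b - G a) * (c - b).
Proof.
move=> /concave_functionP cG a0 ab bc.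
have ac : a < c by exact: lt_trans bc.
have ca0 : 0 < c - a by rewrite subr_gt0.
pose t := (c - b) / (c - a).
have t0 : 0 <= t by rewrite /t divr_ge0 ?subr_ge0 ?ltW.
have t1 : t <= 1 by rewrite /t ler_pdivrMr// mul1r; lra.
have := cG t a c t0 t1 a0 (lt_trans a0 ac).
have tE : t * (c - a) = c - b by rewrite /t divfK// gt_eqF.
have -> : t * a + (1 - t) * c = b by lra.
move=> /(ler_wpM2r (ltW ca0)).
have -> : (t * G a + (1 - t) * G c) * (c - a) =
    t * (c - a) * G a + (c - a - t * (c - a)) * G c by ring.
by rewrite tE; lra.
Qed.

(** For s < 0 the tail is constantly 1, and for s = 0 it is the indicator of
    a > 0 because F 0 = 0. For s > 0 it is G(a / s) with G(u) = 1 - F(1/u) if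
    a > 0, and 0 if a = 0; the slope condition at 0 follows from those on
    ]0, +oo[ since G is nonnegative. *)
Lemma concave_scaled_tail s : concave_function [set x | 0 < x] G ->
  concave_nneg (scaled_tail s).
Proof.
move=> cG a b c a0 ab bc; rewrite /scaled_tail.
have b0 : 0 < b by exact: le_lt_trans ab.
have c0 : 0 < c by exact: lt_trans bc.
rewrite (gt_eqF b0) (gt_eqF c0).
have [s0|s0|s0] := ltrgtP s 0.
- have neg x : 0 < x -> F (s / x) = 0.
    by move=> x0; rewrite df_neg// pmulr_llt0// invr_gt0.
  rewrite (neg b b0) (neg c c0); case: ifPn => an0.
    by rewrite subr0 !subrr !mul0r.
  have a0' : 0 < a by rewrite lt_neqAle eq_sym an0.
  by rewrite neg// !subrr !mul0r.
- have sE x : 0 < x -> 1 - F (s / x) = G (x / s).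
    by move=> x0; rewrite /G invf_div.
  have G0 x : 0 <= G x by rewrite subr_ge0 df_le1.
  rewrite (sE b b0) (sE c c0); set bs := b / s; set cs := c / s.
  have bs0 : 0 < bs by rewrite divr_gt0.
  have bcs : bs < cs by rewrite ltr_pM2r ?invr_gt0.
  have [bE cE] : b = bs * s /\ c = cs * s by rewrite !divfK ?gt_eqF.
  clearbody bs cs.
  case: ifPn => an0.
    rewrite (eqP an0) subr0 subr0 bE cE -mulrBl !mulrA ler_pM2r//.
    (* If the slope condition failed at 0, so that D bs > M, it would still fail
       at the left point e for which D (bs - e) is the mean of D bs and M. *)
    rewrite leNgt; apply/negP => lt0.
    set D := G cs - G bs in lt0; set M := G bs * (cs - bs) in lt0.
    have M0 : 0 <= M by rewrite mulr_ge0// subr_ge0 ltW.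
    have D0 : 0 < D by rewrite -(pmulr_lgt0 _ bs0) (le_lt_trans M0 lt0).
    pose e := (D * bs - M) / (2 * D).
    have eD : e * D = (D * bs - M) / 2.
      by rewrite /e; field; rewrite gt_eqF.
    have e0 : 0 < e by rewrite divr_gt0 ?subr_gt0// mulr_gt0.
    have ebs : e < bs.
      by rewrite -(ltr_pM2r D0) eD; nra.
    have := concave_three_points cG e0 ebs bcs.
    rewrite -/D; have := G0 e; have : 0 < cs - bs by rewrite subr_gt0.
    rewrite /M in lt0 eD *; nra.
  have a0' : 0 < a by rewrite lt_neqAle eq_sym an0.
  rewrite sE//; set as_ := a / s.
  have aE : a = as_ * s by rewrite divfK ?gt_eqF.
  have abs : as_ < bs by rewrite -(ltr_pM2r s0) -aE -bE.
  have as0 : 0 < as_ by rewrite divr_gt0.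
  clearbody as_.
  rewrite aE bE cE -!mulrBl !mulrA ler_pM2r//.
  exact: concave_three_points.
- rewrite s0 !mul0r df0 subr0 subrr mul0r.
  by case: ifPn => _; rewrite ?subr0 ?subrr ?mul0r// mul1r subr_ge0 ltW.
Qed.

End df_facts.

(** * Inverted concavity implies property (SD) *)
Section weighted_sums.
Context {R : realType}.
Variable F : cumulativeBounded (0 : R) (1 : R).
Local Open Scope ereal_scope.

(** The operator of the sum, over a in s, of the laws of a Y: up to normalization,
    the jump law of the weighted sum. *)
Definition mixture (s : seq R) (f : R -> \bar R) (x : R) : \bar R :=
  \sum_(a <- s) shift (df_law F) a f x.

Lemma sigma_operator_mixture s : sigma_operator (mixture s).
Proof. by apply: sigma_operator_sum => a; exact: sigma_operator_shift. Qed.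

Lemma commuting_shift_mixture nu b s : commuting (shift nu b) (mixture s).
Proof.
apply: commuting_sum => [|a|a]; first exact: sigma_operator_shift.
  exact: sigma_operator_shift.
exact: commuting_shift.
Qed.

Lemma commuting_mixture s s' : commuting (mixture s) (mixture s').
Proof.
apply: commuting_sum => [|a|a]; first exact: sigma_operator_mixture.
  exact: sigma_operator_shift.
by apply: commuting_sym; exact: commuting_shift_mixture.
Qed.

(** Composing the operators e^-lambda exp(lambda S_a) adds the exponents. *)
Lemma foldr_shift_compound (lambda : R) (mu : probability R R) s f :
  (0 < lambda)%R ->
  (forall a g, nnmeasurable g -> shift mu a g = fun x =>
    (expR (- lambda))%:E * exp_operator lambda (shift (df_law F) a) g x) ->
  nnmeasurable f ->
  foldr (fun a g => shift mu a g) f s = fun x =>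
    (expR (- lambda) ^+ size s)%:E * exp_operator lambda (mixture s) f x.
Proof.
move=> l0 muE nf; elim: s => [|a s ih].
  apply/funext => x; rewrite /= expr0 mul1e.
  rewrite (_ : mixture [::] = (fun _ _ => 0)) ?exp_operator0//.
  by apply/funext => g; apply/funext => y; rewrite /mixture big_nil.
have nexp : nnmeasurable (exp_operator lambda (mixture s) f).
  by apply: nnmeasurable_exp => //; [exact: ltW|exact: sigma_operator_mixture].
have e0 : (0 <= expR (- lambda) ^+ size s)%R by rewrite exprn_ge0// expR_ge0.
rewrite /= ih (sop_scale (sigma_operator_shift mu a))//.
apply/funext => x; rewrite muE//.
rewrite -exp_operator_add//; last 4 first.
- exact: ltW.
- exact: sigma_operator_shift.
- exact: sigma_operator_mixture.
- exact: commuting_shift_mixture.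
rewrite muleA -EFinM -exprSr; congr (_ * exp_operator _ _ _ _).
by apply/funext => g; apply/funext => y; rewrite /mixture big_cons.
Qed.

Lemma cdf_weighted_sum (lambda : R) (mu : probability R R) n
    (d : measure_display) (T : measurableType d) (P : probability T R)
    (X : 'I_n -> {RV P >-> R}) (theta : 'rV[R]_n) t :
  (0 < lambda)%R -> compound_poisson lambda F mu ->
  (forall i, has_law (X i) mu) -> mutually_independent X ->
  cdf (weighted_sum theta X : {RV P >-> R}) t = (expR (- lambda) ^+ n)%:E *
    exp_operator lambda (mixture [seq theta 0%R i | i : 'I_n]) (heaviside t) 0%R.
Proof.
move=> l0 [d' [T' [P' [N [Y [NP YF iY iNY Smu]]]]]] Xmu iX.
have nH := nnmeasurable_heaviside t.
have -> : cdf (weighted_sum theta X : {RV P >-> R}) t =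
    \int[P]_w heaviside t (0 + linear_comb X (theta 0%R) (enum 'I_n) w)%R.
  have mI : measurable (weighted_sum theta X @^-1` `]-oo, t]%classic).
    by rewrite -[_ @^-1` _]setTI; exact: measurable_funPT.
  transitivity (\int[P]_w
      (\1_(weighted_sum theta X @^-1` `]-oo, t]%classic) w)%:E).
    by rewrite integral_indic// setIT.
  apply: eq_integral => w _; rewrite /heaviside add0r /linear_comb big_enum/=.
  by [].
rewrite (expectation_linear_comb iX)//; last exact: enum_uniq.
rewrite (_ : foldr _ _ _ = foldr (fun a g => shift mu a g) (heaviside t)
   [seq theta 0%R i | i : 'I_n]); last first.
  rewrite /image_mem foldr_map; elim: (enum _) => // i s ih; rewrite [LHS]/= [RHS]/= ih.
  by apply/funext => x; apply: eq_measure_integral => A mA _; exact: Xmu.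
rewrite (@foldr_shift_compound lambda mu)// ?size_map -?enumT ?size_enum_ord//.
by move=> a g ng; exact: (shift_compound_poisson a l0 NP YF iY iNY Smu ng).
Qed.

Lemma mixture_heaviside (n : nat) (theta : 'rV[R]_n) t x :
  (forall i, (0 <= theta 0 i)%R) ->
  mixture [seq theta 0%R i | i : 'I_n] (heaviside t) x =
  (n%:R - \sum_(i < n) scaled_tail F (t - x) (theta 0 i))%:E%R.
Proof.
move=> th0; rewrite /mixture big_map big_enum/=.
under eq_bigr do rewrite shift_heaviside//.
by rewrite sumEFin sumrB sumr_const card_ord.
Qed.

Lemma SD_of_inverted_concave (lambda : R) (mu : probability R R) :
  continuous (F : R -> R) -> inverted_concave F -> (0 < lambda)%R ->
  compound_poisson lambda F mu -> SD mu.
Proof.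
move=> Fc [Finf cG] l0 cp n _ d T P X Xmu iX theta eta th0 et0 maj t.
rewrite !(cdf_weighted_sum _ _ l0 cp Xmu iX).
rewrite lee_pmul2l ?lte_fin ?exprn_gt0 ?expR_gt0//.
have nH := nnmeasurable_heaviside t.
have sM := sigma_operator_mixture.
apply: lee_nneseries => k _.
  move=> _; rewrite mule_ge0//; first by rewrite lee_fin exp_coefficient_ge0// ltW.
  by apply: nnmeasurable_ge0; exact: nnmeasurable_iter.
rewrite lee_pmul2l//; last by rewrite lte_fin divr_gt0 ?exprn_gt0// ltr0n fact_gt0.
apply: iter_le => //; first exact: commuting_mixture.
move=> x; rewrite !mixture_heaviside// lee_fin lerD2l lerN2.
by apply: karamata => //; exact: concave_scaled_tail.
Qed.

End weighted_sums.

(** * Iterated splitting; the uniform law and its binary digits *)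
Section iterated_splitting.
Context d (T : measurableType d) (R : realType) (P : probability T R).
Context d' (T' : measurableType d').
Variables (e : T -> T') (o : T -> T).
Hypotheses (me : measurable_fun setT e) (mo : measurable_fun setT o).
Local Open Scope ereal_scope.
Hypothesis split_indep : forall A B, measurable A -> measurable B ->
  P (e @^-1` A `&` o @^-1` B) = P (e @^-1` A) * P B.

Definition iterate_part j w := e (iter j o w).

Lemma measurable_iterate_part j : measurable_fun setT (iterate_part j).
Proof.
apply: measurableT_comp => //; elim: j => [|j ih]; first exact: measurable_id.
by rewrite (_ : iter _ o = o \o iter j o)//; exact: measurableT_comp.
Qed.

Let initial_prod n (A : nat -> set T') : (forall j, measurable (A j)) ->
  P (\bigcap_(j < n) (iterate_part j @^-1` A j)) =
  \prod_(j < n) P (e @^-1` A j).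
Proof.
elim: n A => [|n ih] A mA.
  by rewrite bigcap_mkord !big_ord0 probability_setT.
have -> : \bigcap_(j < n.+1) (iterate_part j @^-1` A j) =
    e @^-1` A 0%N `&` o @^-1` (\bigcap_(j < n) (iterate_part j @^-1` A j.+1)).
  apply/seteqP; split => w.
    move=> h; split; first exact: (h 0%N).
    move=> j /= jn; rewrite /preimage /= /iterate_part -iterSr.
    exact: (h j.+1).
  move=> [h0 h] [|j] /= jn; first exact: h0.
  by rewrite /preimage /= /iterate_part iterSr; exact: (h j).
rewrite split_indep//; last first.
  rewrite bigcap_mkord; apply: bigsetI_measurable => j _.
  by rewrite -[X in measurable X]setTI; exact: measurable_iterate_part.
by rewrite (ih (fun j => A j.+1))// big_ord_recl.
Qed.

(** If e and o split a random point into independent parts and o preserves the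
    law, then e, e o, e o^2, ... are independent: split off e first, the others
    are functions of o. *)
Lemma iterate_part_independent (J : seq nat) (A : nat -> set T') :
  uniq J -> (forall j, measurable (A j)) ->
  P (\bigcap_(j in [set` J]) (iterate_part j @^-1` A j)) =
  \prod_(j <- J) P (e @^-1` A j).
Proof.
move=> uJ mA.
pose A' j := if j \in J then A j else setT.
pose n := (\max_(j <- J) j).+1.
have Jn j : j \in J -> (j < n)%N by move=> jJ; rewrite ltnS leq_bigmax_seq.
have -> : \bigcap_(j in [set` J]) (iterate_part j @^-1` A j) =
    \bigcap_(j < n) (iterate_part j @^-1` A' j).
  apply/seteqP; split => w h j /=.
    by move=> jn; rewrite /A'; case: ifPn => // jJ; exact: h.
  by move=> jJ; have := h j (Jn _ jJ); rewrite /A' jJ.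
rewrite initial_prod; last by move=> j; rewrite /A'; case: ifP.
transitivity (\prod_(j < n | (j : nat) \in J) P (e @^-1` A j)).
  rewrite [RHS]big_mkcond/=; apply: eq_bigr => j _; rewrite /A'.
  by case: ifP => // _; rewrite preimage_setT probability_setT.
rewrite -(big_mkord (mem J) (fun j => P (e @^-1` A j))) -big_filter.
apply: perm_big; apply: uniq_perm => //.
  by rewrite filter_uniq// iota_uniq.
move=> j; rewrite mem_filter mem_index_iota /= andb_idr//; exact: Jn.
Qed.

End iterated_splitting.

Section unit_law.
Context {R : realType}.

(** The distribution function of the uniform law on [0, 1], equal to
    max(0, min(x, 1)); this closed form makes its continuity immediate. *)
Definition clip (x : R) : R := (`|x| - `|x - 1| + 1) / 2.

Lemma clip_le0 x : x <= 0 -> clip x = 0.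
Proof.
move=> x0; rewrite /clip ler0_norm// ler0_norm ?subr_le0 ?(le_trans x0)//.
by field.
Qed.

Lemma clip_id x : 0 <= x <= 1 -> clip x = x.
Proof.
move=> /andP[x0 x1]; rewrite /clip ger0_norm// ler0_norm ?subr_le0//.
by field.
Qed.

Lemma clip_ge1 x : 1 <= x -> clip x = 1.
Proof.
move=> x1; rewrite /clip !ger0_norm ?subr_ge0 ?(le_trans _ x1)//.
by field.
Qed.

Lemma clip_nondecreasing : nondecreasing_fun clip.
Proof.
move=> x y xy.
have [x0|x0] := leP x 0; have [x1|x1] := leP 1 x;
  have [y0|y0] := leP y 0; have [y1|y1] := leP 1 y;
  try (by lra); rewrite ?(clip_le0 x0) ?(clip_ge1 x1) ?(clip_le0 y0)
    ?(clip_ge1 y1)//.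
- by rewrite clip_id ?ltW//; lra.
- by rewrite clip_id// !ltW.
- by rewrite !clip_id// !ltW.
Qed.

Lemma continuous_clip : continuous clip.
Proof.
move=> x; rewrite /clip; apply: cvgM; last exact: cvg_cst.
apply: cvgD; last exact: cvg_cst.
apply: cvgB; first by apply: cvg_norm; exact: cvg_id.
by apply: cvg_norm; apply: cvgB; [exact: cvg_id|exact: cvg_cst].
Qed.

HB.instance Definition _ := isCumulative.Build R _ R clip
  clip_nondecreasing (right_continuousW continuous_clip).

Lemma clip_cvgNy : clip @ -oo --> (0 : R).
Proof.
apply: cvg_near_cst; near=> x; apply: clip_le0.
by near: x; exact: nbhs_ninfty_le.
Unshelve. all: end_near. Qed.

Lemma clip_cvgy : clip @ +oo --> (1 : R).
Proof.
apply: cvg_near_cst; near=> x; apply: clip_ge1.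
by near: x; exact: nbhs_pinfty_ge.
Unshelve. all: end_near. Qed.

HB.instance Definition _ := isCumulativeBounded.Build R 0 1 clip
  clip_cvgNy clip_cvgy.

Definition unit_law : probability R R := df_law clip.

Lemma unit_law_cdf x : unit_law `]-oo, x]%classic = (clip x)%:E.
Proof. exact: df_law_cdf. Qed.

Lemma unit_law_oc a b : a <= b ->
  unit_law `]a, b]%classic = (clip b - clip a)%:E.
Proof.
move=> ab.
have -> : `]a, b]%classic = `]-oo, b] `\` `]-oo, a] :> set R.
  by rewrite -[RHS]setCK setCD setCitvl setUC -[LHS]setCK setCitv.
rewrite measureD//; last first.
  by rewrite (le_lt_trans (probability_le1 _ _))// ltry.
rewrite setIidr; last by apply: subset_itvl; rewrite bnd_simp.
by rewrite EFinB -!unit_law_cdf.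
Qed.

(** The first binary digit and the remaining fraction. The interval of digit 0 is
    closed at 1/2, so that events on both digits are differences of rays
    ]-oo, x], whose law is given by the distribution function. *)
Definition digit (u : R) : bool := 2^-1 < u.
Definition doubling (u : R) : R := 2 * u - (digit u)%:R.

Lemma measurable_digit : measurable_fun setT digit.
Proof. exact: measurable_fun_ltr. Qed.

Lemma measurable_doubling : measurable_fun setT doubling.
Proof.
apply: measurable_funB; first exact: measurable_funM.
rewrite (_ : (fun u => _) = (fun u => if digit u then 1 else 0)); last first.
  by apply/funext => u; case: digit.
by apply: measurable_fun_ifT => //; exact: measurable_digit.
Qed.

Let clip_half : clip 2^-1 = 2^-1.
Proof. by rewrite clip_id// invr_ge0 ler0n/= invf_le1// ler1n. Qed.

Let digit_false : digit @^-1` [set false] = `]-oo, 2^-1]%classic.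
Proof.
apply/seteqP; split=> u /=; rewrite in_itv/= /digit leNgt.
  by move=> ->.
by move=> /negbTE ->.
Qed.

Let digit_true : digit @^-1` [set true] = ~` `]-oo, 2^-1]%classic.
Proof.
apply/seteqP; split=> u /=; rewrite in_itv/= /digit leNgt.
  by move=> ->.
by move=> /negP; rewrite negbK.
Qed.

Lemma unit_law_digit b : unit_law (digit @^-1` [set b]) = (2^-1)%:E.
Proof.
case: b; last by rewrite digit_false unit_law_cdf clip_half.
rewrite digit_true probability_setC// unit_law_cdf clip_half -EFinB.
by congr (_%:E); lra.
Qed.

Lemma unit_law_doubling_digit_ray x b :
  unit_law (doubling @^-1` `]-oo, x]%classic `&` digit @^-1` [set b]) =
  (clip x / 2)%:E.
Proof.
case: b.
  have [x0|x0] := ltP x 0.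
    rewrite clip_le0 ?ltW// mul0r (_ : _ `&` _ = set0) ?measure0//.
    apply/seteqP; split => // u /=; rewrite in_itv/= /doubling => -[+ du].
    have du' : 2^-1 < u by [].
    by rewrite du /= => ?; lra.
  have -> : doubling @^-1` `]-oo, x]%classic `&` digit @^-1` [set true] =
      `]2^-1, ((x + 1) / 2)%R]%classic.
    apply/seteqP; split => u /=; rewrite !in_itv/= /doubling.
      move=> [+ du]; have du' : 2^-1 < u by [].
      by rewrite du du' /= => ?; lra.
    by move=> /andP[du ux]; rewrite /digit du; split => //=; lra.
  rewrite unit_law_oc; last by lra.
  rewrite clip_half; congr (_%:E).
  have [x1|x1] := leP 1 x; first by rewrite !clip_ge1//; lra.
  by rewrite !clip_id; lra.
have -> : doubling @^-1` `]-oo, x]%classic `&` digit @^-1` [set false] =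
    `]-oo, (Num.min x 1 / 2)%R]%classic.
  apply/seteqP; split => u /=; rewrite !in_itv/= /doubling.
    move=> [+ du]; rewrite du; move: du; rewrite /digit => /negbT.
    rewrite -leNgt ler_pdivlMr// le_min => u2 /= h.
    by apply/andP; split; lra.
  rewrite ler_pdivlMr// le_min => /andP[ux u1].
  have du : digit u = false by apply/negbTE; rewrite -leNgt; lra.
  by rewrite du; split => //=; lra.
rewrite unit_law_cdf; congr (_%:E).
have [x0|x0] := leP x 0.
  rewrite min_l; last by lra.
  by rewrite !clip_le0//; lra.
have [x1|x1] := leP 1 x.
  by rewrite (clip_ge1 x1) mul1r clip_half.
by rewrite !clip_id; lra.
Qed.

Lemma unit_law_doubling B : measurable B ->
  unit_law (doubling @^-1` B) = unit_law B.
Proof.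
pose D : {mfun R >-> R} := HB.pack doubling
  (isMeasurableFun.Build _ _ _ _ _ measurable_doubling).
apply: (@probability_unique_cdf _ (distribution unit_law D) unit_law) => x.
rewrite unit_law_cdf /distribution /pushforward.
transitivity (unit_law
    (doubling @^-1` `]-oo, x]%classic `&` digit @^-1` [set true] `|`
     doubling @^-1` `]-oo, x]%classic `&` digit @^-1` [set false])).
  by rewrite -setIUr digit_true digit_false setUC setUv setIT.
have mD : measurable (doubling @^-1` `]-oo, x]%classic).
  by rewrite -[_ @^-1` _]setTI; exact: measurable_doubling.
have mb b : measurable (digit @^-1` [set b]).
  by rewrite -[_ @^-1` _]setTI; exact: measurable_digit.
rewrite measureU; last 3 first.
- exact: measurableI.
- exact: measurableI.
- rewrite setIACA digit_true digit_false setICl setI0//.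
transitivity ((clip x / 2)%:E + (clip x / 2)%:E)%E.
  by congr (_ + _)%E; exact: unit_law_doubling_digit_ray.
by rewrite -EFinD; congr (_%:E); lra.
Qed.

(** On each half of [0, 1] the doubling map is affine onto [0, 1], so given the
    first digit the rest is still uniform. *)
Lemma unit_law_split (A : set bool) B : measurable A -> measurable B ->
  unit_law (digit @^-1` A `&` doubling @^-1` B) =
  (unit_law (digit @^-1` A) * unit_law B)%E.
Proof.
move=> _ mB.
have mb b : measurable (digit @^-1` [set b]).
  by rewrite -[_ @^-1` _]setTI; exact: measurable_digit.
have one b : unit_law (doubling @^-1` B `&` digit @^-1` [set b]) =
    (unit_law (doubling @^-1` B) * unit_law (digit @^-1` [set b]))%E.
  apply: (independent_of_event_generated measurable_doubling (mb b)
    measurable_lower_rays lower_raysI) => // _ [x _ <-].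
  rewrite unit_law_doubling_digit_ray unit_law_doubling// unit_law_cdf.
  by rewrite unit_law_digit -EFinM.
have [At|At] := pselect (A true); have [Af|Af] := pselect (A false).
- have -> : A = setT by apply/seteqP; split => // -[].
  by rewrite preimage_setT setTI probability_setT mul1e unit_law_doubling.
- have -> : A = [set true] by apply/seteqP; split => [[]|_ ->].
  by rewrite setIC one unit_law_doubling// muleC.
- have -> : A = [set false] by apply/seteqP; split => [[]|_ ->].
  by rewrite setIC one unit_law_doubling// muleC.
- have -> : A = set0 by apply/seteqP; split => // -[].
  by rewrite preimage_set0 set0I measure0 mul0e.
Qed.

End unit_law.

(** * The law of a sequence of fair coins *)
(** Events that prescribe finitely many coordinates. *)
Definition cylinder (J : seq nat) (c : nat -> bool) : set (nat -> bool) :=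
  [set w | forall j, j \in J -> w j = c j].

Definition cylinders : set (set (nat -> bool)) :=
  [set A | A = set0 \/ exists J c, uniq J /\ A = cylinder J c].

Definition bit_sequence : Type := g_sigma_algebraType cylinders.
HB.instance Definition _ := Measurable.on bit_sequence.

Lemma measurable_bit_sequence : @measurable _ bit_sequence = <<s cylinders >>.
Proof. by []. Qed.

Lemma measurable_cylinder J c : measurable (cylinder J c : set bit_sequence).
Proof.
rewrite (_ : cylinder J c = cylinder (undup J) c).
  apply: sub_sigma_algebra; right; exists (undup J), c; split => //.
  exact: undup_uniq.
by apply/seteqP; split => w h j; have := h j; rewrite mem_undup.
Qed.

Lemma cylindersI : setI_closed cylinders.
Proof.
move=> A B [->|[J [c [uJ ->]]]]; first by rewrite set0I; left.
move=> [->|[K [c' [uK ->]]]]; first by rewrite setI0; left.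
have [agree|nagree] := pselect (forall j, j \in J -> j \in K -> c j = c' j).
  right; exists (undup (J ++ K)), (fun j => if j \in J then c j else c' j).
  split; first exact: undup_uniq.
  apply/seteqP; split => w.
    move=> [wJ wK] j; rewrite mem_undup mem_cat; case: ifPn => [jJ _|_ /= jK].
      exact: wJ.
    exact: wK.
  move=> h; split => j jJ.
    by rewrite h ?jJ// mem_undup mem_cat jJ.
  rewrite h ?mem_undup ?mem_cat ?jJ ?orbT//; case: ifPn => // jJ'.
  exact: agree.
left; apply/seteqP; split => // w [wJ wK]; apply: nagree => j jJ jK.
by rewrite -wJ// wK.
Qed.

Lemma measurable_reindex (phi : nat -> nat) :
  measurable_fun setT (fun w : bit_sequence => (fun i => w (phi i)) : bit_sequence).
Proof.
apply: (measurability _ measurable_bit_sequence).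
move=> _ [A [->|[J [c [uJ ->]]]] <-]; first by rewrite preimage_set0 setI0.
rewrite setTI.
have [comp|ncomp] := pselect
  (forall i j, i \in J -> j \in J -> phi i = phi j -> c i = c j).
  pose c' m := c (nth 0%N J (index m (map phi J))).
  rewrite (_ : _ @^-1` _ = cylinder (map phi J) c'); first exact: measurable_cylinder.
  have c'E j : j \in J -> c' (phi j) = c j.
    move=> jJ; have pJ : phi j \in map phi J by exact: map_f.
    apply: comp => //; first by rewrite mem_nth// -(size_map phi) index_mem.
    by rewrite -(nth_map 0%N 0%N) ?nth_index// -(size_map phi) index_mem.
  apply/seteqP; split => w /=.
    by move=> h _ /mapP[j jJ ->]; rewrite c'E//; exact: h.
  by move=> h j jJ; rewrite /= h ?c'E//; exact: map_f.
rewrite (_ : _ @^-1` _ = set0)//; apply/seteqP; split => // w h.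
apply: ncomp => i j iJ jJ ij.
by rewrite -(h i iJ) -(h j jJ) ij.
Qed.

Definition even_part (w : bit_sequence) : bit_sequence := fun i => w i.*2.
Definition odd_part (w : bit_sequence) : bit_sequence := fun i => w i.*2.+1.

Section coin_law.
Context {R : realType}.
Local Open Scope ereal_scope.

Definition binary_digits (u : R) : bit_sequence := fun i => digit (iter i doubling u).

Lemma binary_digits_cylinder J c : binary_digits @^-1` cylinder J c =
  \bigcap_(j in [set` J]) (iterate_part digit doubling j @^-1` [set c j] : set R).
Proof. by apply/seteqP; split => u h j /h. Qed.

Lemma measurable_binary_digits : measurable_fun setT binary_digits.
Proof.
apply: (measurability _ measurable_bit_sequence).
move=> _ [A [->|[J [c [uJ ->]]]] <-]; first by rewrite preimage_set0 setI0.
rewrite setTI binary_digits_cylinder bigcap_seq.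
apply: bigsetI_measurable => j _.
rewrite -[X in measurable X]setTI.
by apply: (measurable_iterate_part measurable_digit measurable_doubling).
Qed.

HB.instance Definition _ := isMeasurableFun.Build _ _ _ _ binary_digits
  measurable_binary_digits.

Definition coin_law : probability bit_sequence R :=
  distribution (@unit_law R) binary_digits.

Lemma coin_law_cylinder J c : uniq J ->
  coin_law (cylinder J c) = ((2^-1) ^+ size J)%:E.
Proof.
move=> uJ; transitivity (unit_law (binary_digits @^-1` cylinder J c)) => //.
rewrite binary_digits_cylinder.
rewrite (iterate_part_independent measurable_digit measurable_doubling)//; last first.
  exact: unit_law_split.
under eq_bigr do rewrite unit_law_digit.
by rewrite prodEFin big_const_seq count_predT iter_mulr_1.
Qed.

(** Coins are exchangeable: an injective choice of coordinates preserves the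
    probabilities of cylinders. *)
Lemma coin_law_reindex (phi : nat -> nat) A : injective phi -> measurable A ->
  coin_law ((fun w : bit_sequence => (fun i => w (phi i)) : bit_sequence) @^-1` A)
  = coin_law A.
Proof.
move=> phi_inj.
pose D : {mfun bit_sequence >-> bit_sequence} := HB.pack
  (fun w : bit_sequence => (fun i => w (phi i)) : bit_sequence)
  (isMeasurableFun.Build _ _ _ _ _ (measurable_reindex phi)).
move=> mA; change (distribution coin_law D A = coin_law A); move: A mA.
refine (@measure_unique _ R bit_sequence cylinders
  (fun=> cylinder [::] (fun=> true)) measurable_bit_sequence cylindersI _ _
  (distribution coin_law D) coin_law _ _).
- by move=> _; right; exists [::], (fun=> true).
- by apply/seteqP; split => // w _; exists 0%N.
- move=> _ [->|[J [c [uJ ->]]]]; first by rewrite !measure0.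
  transitivity (((2^-1 : R) ^+ size J)%:E); last exact/esym/coin_law_cylinder.
  pose c' m := c (nth 0%N J (index m (map phi J))).
  have c'E j : j \in J -> c' (phi j) = c j.
    by move=> jJ; rewrite /c' index_map// nth_index.
  transitivity (coin_law (cylinder (map phi J) c')).
    congr (coin_law _); apply/seteqP; split => w /=.
      by move=> h _ /mapP[j jJ ->]; rewrite c'E//; exact: h.
    by move=> h j jJ; rewrite /= h ?c'E//; exact: map_f.
  by rewrite -(size_map phi); apply: coin_law_cylinder; rewrite map_inj_uniq.
- by move=> k; rewrite (le_lt_trans (probability_le1 _ _))// ?ltry//; exact: measurable_cylinder.
Qed.

(** Both parts read disjoint sets of coins. Independence is checked on cylinders
    and extended to one part at a time by [independent_of_event_generated]. *)
Lemma coin_law_split A B : measurable A -> measurable B ->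
  coin_law (even_part @^-1` A `&` odd_part @^-1` B) =
  coin_law (even_part @^-1` A) * coin_law B.
Proof.
have mE : measurable_fun setT even_part by exact: measurable_reindex.
have mO : measurable_fun setT odd_part by exact: measurable_reindex.
have LE C : measurable C -> coin_law (even_part @^-1` C) = coin_law C.
  by apply: (@coin_law_reindex double); exact: double_inj.
have LO C : measurable C -> coin_law (odd_part @^-1` C) = coin_law C.
  by apply: (@coin_law_reindex (S \o double)) => i j [] /double_inj.
have mpE C : measurable C -> measurable (even_part @^-1` C).
  by move=> mC; rewrite -[_ @^-1` _]setTI; exact: mE.
have mpO C : measurable C -> measurable (odd_part @^-1` C).
  by move=> mC; rewrite -[_ @^-1` _]setTI; exact: mO.
have mG C : cylinders C -> measurable (C : set bit_sequence).
  by move=> GC; exact: sub_sigma_algebra.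
(* the two cylinders together form a cylinder on the disjoint positions L *)
have step1 C D : cylinders C -> cylinders D ->
    coin_law (odd_part @^-1` D `&` even_part @^-1` C) =
    coin_law (odd_part @^-1` D) * coin_law (even_part @^-1` C).
  move=> GC GD; rewrite LE ?LO; [|exact: mG..].
  case: GC => [->|[J [c [uJ ->]]]].
    by rewrite preimage_set0 setI0 measure0 mule0.
  case: GD => [->|[K [c' [uK ->]]]].
    by rewrite preimage_set0 set0I measure0 mul0e.
  pose L := [seq k.*2.+1 | k <- K] ++ [seq j.*2 | j <- J].
  pose b m := if odd m then c' m./2 else c m./2.
  rewrite (_ : _ `&` _ = cylinder L b).
    rewrite !coin_law_cylinder ?size_cat ?size_map ?exprD ?EFinM//.
    rewrite cat_uniq !map_inj_uniq ?uJ ?uK /= ?andbT//; last 2 first.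
    - exact: double_inj.
    - by move=> i j [] /double_inj.
    apply/hasPn => _ /mapP[j _ ->]; apply/mapP => -[k _].
    by move=> /(congr1 odd); rewrite /= !odd_double.
  apply/seteqP; split => w.
    move=> [h1 h2] m; rewrite mem_cat => /orP[] /mapP[j jJ ->].
      by rewrite /b /= odd_double /= uphalf_double; exact: h1.
    by rewrite /b odd_double doubleK; exact: h2.
  move=> h; split => j jJ.
    rewrite [LHS]h /b /= ?odd_double /= ?uphalf_double//.
    by rewrite mem_cat map_f.
  rewrite [LHS]h /b /= ?odd_double /= ?doubleK//.
  by rewrite mem_cat map_f ?orbT.
have step2 C D : cylinders C -> measurable D ->
    coin_law (odd_part @^-1` D `&` even_part @^-1` C) =
    coin_law (odd_part @^-1` D) * coin_law (even_part @^-1` C).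
  move=> GC; apply: (independent_of_event_generated mO _
    measurable_bit_sequence cylindersI); first by apply: mpE; exact: mG.
  by move=> E GE; exact: step1.
move=> mA mB; rewrite -(LO B)//.
apply: (independent_of_event_generated mE (mpO _ mB)
    measurable_bit_sequence cylindersI) => // E GE.
by rewrite setIC step2// muleC.
Qed.

End coin_law.

(** * Existence of compound Poisson laws *)
Section binary_expansion.
Context {R : realType}.

Definition binary_value (w : bit_sequence) : R :=
  fine (\sum_(i <oo) ((w i)%:R / 2 ^+ i.+1)%:E)%E.

Lemma measurable_binary_value : measurable_fun setT binary_value.
Proof.
apply: (measurableT_comp (f := fine)) => //.
apply: ge0_emeasurable_sum => [i w _ _|i _].
  by rewrite lee_fin divr_ge0// exprn_ge0.
apply/measurable_EFinP; apply: measurable_funM => //.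
rewrite (_ : (fun w : bit_sequence => _) =
    (fun w : bit_sequence => if w i then 1 else 0 : R)); last first.
  by apply/funext => w; case: (w i).
apply: measurable_fun_ifT => //.
apply: (measurable_fun_bool true).
rewrite setTI (_ : _ @^-1` _ = cylinder [:: i] (fun=> true)).
  exact: measurable_cylinder.
apply/seteqP; split => w /=.
  by move=> h j; rewrite inE => /eqP ->.
by apply; rewrite mem_head.
Qed.

Lemma doubling_unit u : 0 <= u <= 1 -> 0 <= @doubling R u <= 1.
Proof.
move=> /andP[u0 u1]; rewrite /doubling /digit.
by case: ltP => h /=; apply/andP; split; lra.
Qed.

Lemma iter_doubling_unit n u : 0 <= u <= 1 -> 0 <= iter n (@doubling R) u <= 1.
Proof. by move=> u01; elim: n => //= n; exact: doubling_unit. Qed.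

Lemma binary_partial_sum n u :
  \sum_(i < n) (binary_digits u i)%:R / 2 ^+ i.+1 =
  u - iter n (@doubling R) u / 2 ^+ n.
Proof.
elim: n => [|n ih]; first by rewrite big_ord0 expr0 divr1 subrr.
rewrite big_ord_recr /= ih {2}/doubling /binary_digits exprS.
by field; rewrite expf_neq0.
Qed.

(** The n-th partial sum differs from u by the n-th iterate of the doubling map
    over 2^n ([binary_partial_sum]), and the iterates stay in [0, 1]. *)
Lemma binary_digitsK u : 0 <= u <= 1 -> binary_value (binary_digits u) = u.
Proof.
move=> u01; rewrite /binary_value.
suff -> : (\sum_(i <oo) ((binary_digits u i)%:R / 2 ^+ i.+1)%:E)%E = u%:E by [].
apply/cvg_lim => //.
under eq_fun do rewrite sumEFin big_mkord binary_partial_sum.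
apply: cvg_EFin; first by near=> n.
apply: (@squeeze_cvgr _ _ _ R (fun n : nat => u - 2^-1 ^+ n) (fun=> u)).
- apply: nearW => n /=.
  have /andP[s0 s1] := iter_doubling_unit n u01.
  have p0 : 0 < 2 ^+ n :> R by rewrite exprn_gt0.
  rewrite lerB//= ?exprVn ?ler_pdivrMr ?mulVf ?gt_eqF//.
  by rewrite gerDl oppr_le0 divr_ge0// ltW.
- rewrite -[X in _ --> X]subr0; apply: cvgB; first exact: cvg_cst.
  by apply: cvg_expr; rewrite ger0_norm ?invf_lt1// ltr1n.
- exact: cvg_cst.
Unshelve. all: end_near. Qed.

End binary_expansion.

Section quantile.
Context {R : realType}.
Variable F : cumulativeBounded (0 : R) (1 : R).

(** Set to 0 outside ]0, 1[, where the infimum need not make sense. *)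
Definition quantile (u : R) : R :=
  if 0 < u < 1 then inf [set x | u <= F x] else 0.

(** F is nondecreasing and right continuous, so the infimum is attained. *)
Lemma quantile_le u x : 0 < u < 1 -> (quantile u <= x) = (u <= F x).
Proof.
move=> u01; rewrite /quantile u01; have /andP[u0 u1] := u01.
have nd : nondecreasing_fun F by exact: cumulative_is_nondecreasing.
have lb : has_lbound [set x | u <= F x].
  have [m Fm] : exists m, F m < u.
    have : \forall y \near -oo, F y < u.
      exact: (cvgr_lt _ (cumulativeNy F)).
    by move=> /filter_ex.
  exists m => y /= uy; rewrite leNgt; apply/negP => /ltW ym.
  by have := nd _ _ ym; rewrite leNgt (lt_le_trans Fm).
have ne : [set x | u <= F x] !=set0.
  have : \forall y \near +oo, u < F y.
    exact: (cvgr_gt _ (cumulativey F)).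
  by move=> /filter_ex[y /ltW uy]; exists y.
apply/idP/idP => [infx|ux]; last exact: ge_inf.
have above y : x < y -> u <= F y.
  move=> xy; have : inf [set x | u <= F x] < y by exact: le_lt_trans xy.
  move=> /(inf_lt ne)[z /= uz zy].
  by rewrite (le_trans uz)// nd// ltW.
have rc : F y @[y --> x^'+] --> F x by exact: cumulative_is_right_continuous.
rewrite leNgt; apply/negP => Fxu.
have nearFu : \forall y \near x^'+, F y < u by exact: (cvgr_lt _ rc).
have : \forall y \near x^'+, False.
  near=> y; have : u <= F y.
    by apply: above; near: y; exact: nbhs_right_gt.
  by rewrite leNgt => /negP; apply; near: y.
by move=> /filter_ex[].
Unshelve. all: end_near. Qed.

Lemma measurable_quantile : measurable_fun setT quantile.
Proof.
apply: (measurability _ (@measurable_lower_rays R)).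
move=> _ [_ [x _ <-] <-]; rewrite setTI.
have -> : quantile @^-1` `]-oo, x]%classic =
    (`]-oo, F x]%classic `&` `]0, 1[%classic) `|`
    (if 0 <= x then ~` `]0, 1[%classic else set0).
  apply/seteqP; split => u /=; rewrite in_itv/=.
    have [u01|u01] := boolP (0 < u < 1).
      by rewrite quantile_le// => ux; left; rewrite !in_itv.
    rewrite /quantile (negbTE u01) => ->; right.
    by rewrite /= in_itv/=; exact/negP.
  move=> [[]|]; rewrite ?in_itv/=; first by move=> ux u01; rewrite quantile_le.
  case: ifPn => // x0 /=; rewrite in_itv/= => /negP u01.
  by rewrite /quantile (negbTE u01).
apply: measurableU; first exact: measurableI.
by case: ifP => // _; exact: measurableC.
Qed.

(** The interval ]0, 1 - e] already has probability 1 - e, for every e < 1. *)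
Lemma unit_law_outside : @unit_law R (~` `]0, 1[%classic) = 0%E.
Proof.
apply/eqP; rewrite eq_le measure_ge0 andbT.
apply/lee_addgt0Pr => e e0; rewrite add0e.
have [e1|e1] := leP 1 e.
  by rewrite (le_trans (probability_le1 _ _))//; exact: measurableC.
apply: (@le_trans _ _ (unit_law (~` `]0, 1 - e]%classic))).
  rewrite le_measure ?inE//; [exact: measurableC..|].
  by apply: subsetC; apply: subset_itvl; rewrite bnd_simp; lra.
rewrite probability_setC// unit_law_oc; last by lra.
rewrite (clip_le0 (lexx 0)) clip_id; last by lra.
by rewrite -EFinB lee_fin; lra.
Qed.

Lemma unit_law_mod_outside (A B : set R) : measurable A -> measurable B ->
  A `&` `]0, 1[%classic = B `&` `]0, 1[%classic -> unit_law A = unit_law B.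
Proof.
have key (C : set R) : measurable C -> unit_law C = unit_law (C `&` `]0, 1[%classic).
  move=> mC; rewrite (measureDI (@unit_law R) mC (measurable_itv `]0, 1[)).
  rewrite [X in (X + _)%E](_ : _ = 0%E) ?add0e//.
  apply: (subset_measure0 _ _ _ unit_law_outside) => //.
  - exact: measurableD.
  - exact: measurableC.
by move=> mA mB AB; rewrite key// AB -key.
Qed.

Lemma quantile_binary_value_law x :
  coin_law ((fun w => quantile (binary_value w)) @^-1` `]-oo, x]%classic)
  = (F x)%:E.
Proof.
pose Y (w : bit_sequence) : R := quantile (binary_value w).
have mY : measurable_fun setT Y.
  exact: (measurableT_comp measurable_quantile (@measurable_binary_value R)).
have mq : measurable_fun setT (fun u : R => Y (binary_digits u)).
  exact: (measurableT_comp mY measurable_binary_digits).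
transitivity (@unit_law R
    ((fun u : R => Y (binary_digits u)) @^-1` `]-oo, x]%classic)).
  by [].
rewrite (@unit_law_mod_outside _ `]-oo, F x]%classic)//.
- by rewrite unit_law_cdf clip_id// df_ge0 df_le1.
- by rewrite -[_ @^-1` _]setTI; exact: mq.
- apply/seteqP; split => u; rewrite /Y /= !in_itv/= => -[ux u01]; split => //.
    by move: ux; rewrite binary_digitsK ?quantile_le//;
      case/andP: u01 => ? ?; rewrite !ltW.
  by rewrite binary_digitsK ?quantile_le//;
    case/andP: u01 => ? ?; rewrite !ltW.
Qed.

End quantile.

Section existence.
Context {R : realType}.
Variables (F : cumulativeBounded (0 : R) (1 : R)) (lambda : R).
Hypothesis lambda0 : 0 < lambda.
Local Open Scope ereal_scope.

Let base : probability (nat * bit_sequence)%type R :=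
  (poisson_prob lambda 0%N \x coin_law).

Let count (w : nat * bit_sequence) : nat := w.1.

Let summand (i : nat) (w : nat * bit_sequence) : R :=
  quantile F (binary_value (iterate_part even_part odd_part i w.2)).

Let measurable_count : measurable_fun setT count.
Proof. exact: measurable_fst. Qed.

Let mE : measurable_fun setT even_part.
Proof. exact: measurable_reindex. Qed.
Let mO : measurable_fun setT odd_part.
Proof. exact: measurable_reindex. Qed.

Let value (w : bit_sequence) := quantile F (binary_value w).

Let measurable_value : measurable_fun setT value.
Proof.
apply: measurableT_comp; first exact: measurable_quantile.
exact: measurable_binary_value.
Qed.

Let measurable_summand i : measurable_fun setT (summand i).
Proof.
apply: (measurableT_comp measurable_value).
apply: measurableT_comp => //; exact: measurable_iterate_part.
Qed.

HB.instance Definition _ := isMeasurableFun.Build _ _ _ _ count measurable_count.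
HB.instance Definition _ i :=
  isMeasurableFun.Build _ _ _ _ (summand i) (measurable_summand i).

Let N : {RV base >-> nat} := count.
Let Y i : {RV base >-> R} := summand i.

Let base_rectangle A B : measurable A -> measurable B ->
  base (A `*` B) = poisson_prob lambda 0%N A * coin_law B.
Proof. exact: product_measure1E. Qed.

Let base_snd B : measurable B -> base (snd @^-1` B) = coin_law B.
Proof.
move=> mB; rewrite (_ : _ @^-1` B = setT `*` B).
  by rewrite base_rectangle// probability_setT mul1e.
by apply/seteqP; split => // w [].
Qed.

Let mpv A : measurable A -> measurable (value @^-1` A).
Proof. by move=> mA; rewrite -[_ @^-1` _]setTI; exact: measurable_value. Qed.

Let mpe i A : measurable A ->
  measurable (iterate_part even_part odd_part i @^-1` A).
Proof.
by move=> mA; rewrite -[_ @^-1` _]setTI; exact: (measurable_iterate_part mE mO).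
Qed.

Let summand_law i A : measurable A ->
  base (Y i @^-1` A) = coin_law (even_part @^-1` (value @^-1` A)).
Proof.
move=> mA.
transitivity (base (snd @^-1`
    (iterate_part even_part odd_part i @^-1` (value @^-1` A)))) => //.
rewrite base_snd; last by apply: mpe; exact: mpv.
have := iterate_part_independent mE mO (@coin_law_split R) (J := [:: i])
  (A := fun=> value @^-1` A) isT (fun=> mpv mA).
rewrite big_seq1 => <-; congr (coin_law _).
apply/seteqP; split => w /=; first by move=> h j; rewrite /= inE => /eqP ->.
by apply; rewrite /= mem_head.
Qed.

(** The number of terms lives on the first factor, under the Poisson law, and the
    terms are functions of the coins on the second factor: the two are
    independent by the definition of the product measure. *)
Lemma compound_poisson_exists : exists mu, compound_poisson lambda F mu.
Proof.
pose S : {RV base >-> R} := random_sum N Y.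
exists (distribution base S), _, _, base, N, Y; split.
- move=> k; transitivity (base ([set k] `*` setT)).
    by congr (base _); apply/seteqP; split => // w [].
  rewrite base_rectangle// probability_setT mule1 /poisson_prob lambda0.
  by rewrite esum_set1// lee_fin poisson_pmf_ge0.
- move=> i x; rewrite /cdf /distribution /pushforward summand_law//.
  transitivity (@coin_law R (value @^-1` `]-oo, x]%classic)).
    apply: (coin_law_reindex (phi := double)); first exact: double_inj.
    exact: mpv.
  exact: quantile_binary_value_law.
- move=> J A mA; under eq_bigr do rewrite summand_law//.
  have := iterate_part_independent mE mO (@coin_law_split R) (J := J)
    (A := fun i => value @^-1` A i) (fset_uniq J) (fun i => mpv (mA i)).
  move=> <-.
  rewrite -base_snd.
    by congr (base _); apply/seteqP.
  rewrite bigcap_seq; apply: bigsetI_measurable => j _.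
  by apply: mpe; exact: mpv.
- move=> B E mB.
  have sub : sigma_family Y `<=` [set E | exists2 E', measurable E' & E = snd @^-1` E'].
    apply: smallest_sub.
      split.
      + by exists set0 => //; rewrite preimage_set0.
      + move=> _ [E' mE' ->]; exists (~` E'); first exact: measurableC.
        by rewrite setTD preimage_setC.
      + move=> G hG; have /choice[G' hG'] : forall i, exists E',
            measurable E' /\ G i = snd @^-1` E'.
          by move=> i; have [E' ? ?] := hG i; exists E'.
        exists (\bigcup_i G' i).
          by apply: bigcupT_measurable => i; case: (hG' i).
        by rewrite preimage_bigcup; apply: eq_bigcupr => i _; case: (hG' i).
    move=> _ [i _ [A mA <-]]; rewrite setTI.
    exists (iterate_part even_part odd_part i @^-1` (value @^-1` A)) => //.
    by apply: mpe; exact: mpv.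
  move=> /sub[E' mE' ->]; rewrite base_snd//.
  have -> : N @^-1` B `&` snd @^-1` E' = B `*` E' by [].
  rewrite base_rectangle//; congr (_ * _).
  have -> : N @^-1` B = B `*` setT by apply/seteqP; split => // w [].
  by rewrite base_rectangle// probability_setT mule1.
- by [].
Qed.

End existence.

(** * Property (SD) implies inverted concavity *)
Section midpoint_concavity.
Context {R : realType}.

(** If phi were negative at t0, adding e t (1 - t) with e = - phi t0 would make
    it strictly midpoint concave while keeping it negative at t0. Its minimum
    over [0, 1] would then be reached inside ]0, 1[, which strict midpoint
    concavity excludes. *)
Lemma midpoint_concave_ge0 (phi : R -> R) :
  {within `[0, 1]%classic, continuous phi} -> phi 0 = 0 -> phi 1 = 0 ->
  (forall s t, 0 <= s <= 1 -> 0 <= t <= 1 ->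
     phi s + phi t <= 2 * phi ((s + t) / 2)) ->
  forall t, 0 <= t <= 1 -> 0 <= phi t.
Proof.
move=> cphi phi0 phi1 mid t0 t01; rewrite leNgt; apply/negP => neg.
pose e := - phi t0.
(* t (1 - t) <= 1/4, so that psi t0 <= 3/4 phi t0 < 0 for this e *)
pose psi t := phi t + e * (t * (1 - t)).
have e0 : 0 < e by rewrite /e oppr_gt0.
have cpsi : {within `[0, 1]%classic, continuous psi}.
  have cq : {within `[0, 1]%classic, continuous (fun t : R => e * (t * (1 - t)))}.
    apply: continuous_subspaceT => y.
    apply: cvgM; first exact: cvg_cst.
    by apply: cvgM; [exact: cvg_id|apply: cvgB; [exact: cvg_cst|exact: cvg_id]].
  by move=> x; apply: cvgD; [exact: cphi|exact: cq].
have [c] := EVT_min ler01 cpsi.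
rewrite in_itv/= => /andP[c0 c1] cmin.
have psit0 : psi t0 < 0.
  have /andP[? ?] := t01; have h : 0 < 1 - t0 * (1 - t0) by nra.
  rewrite (_ : psi t0 = phi t0 * (1 - t0 * (1 - t0))); first by rewrite pmulr_llt0.
  by rewrite /psi /e; ring.
have psic : psi c < 0 by apply: le_lt_trans psit0; apply: cmin; rewrite in_itv.
have c0' : 0 < c.
  rewrite lt_neqAle c0 andbT; apply/negP => /eqP cE.
  by move: psic; rewrite /psi -cE phi0 mul0r mulr0 addr0 ltxx.
have c1' : c < 1.
  rewrite lt_neqAle c1 andbT; apply/negP => /eqP cE.
  by move: psic; rewrite /psi cE phi1 subrr !mulr0 addr0 ltxx.
pose del := Num.min c (1 - c).
have del0 : 0 < del by rewrite lt_min c0' subr_gt0.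
have delc : del <= c by rewrite ge_min lexx.
have delc1 : del <= 1 - c by rewrite ge_min lexx orbT.
have i1 : 0 <= c - del <= 1 by apply/andP; split; lra.
have i2 : 0 <= c + del <= 1 by apply/andP; split; lra.
have := mid _ _ i1 i2.
have -> : (c - del + (c + del)) / 2 = c by field.
have := cmin (c - del); rewrite in_itv/= => /(_ i1).
have := cmin (c + del); rewrite in_itv/= => /(_ i2).
have ed0 : 0 < e * (del * del) by rewrite !mulr_gt0.
by rewrite /psi; lra.
Qed.

(** Apply the previous lemma to the difference of g and its chord. *)
Lemma midpoint_concave (g : R -> R) :
  (forall x : R, 0 < x -> {for x, continuous g}) ->
  (forall x y : R, 0 < x -> 0 < y -> g x + g y <= 2 * g ((x + y) / 2)) ->
  concave_function [set x | 0 < x] g.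
Proof.
move=> cg mid; apply/concave_functionP => t x y t0 t1 /= x0 y0.
pose phi s := g (s * x + (1 - s) * y) - (s * g x + (1 - s) * g y).
suff : 0 <= phi t by rewrite subr_ge0.
have pos s : 0 <= s <= 1 -> 0 < s * x + (1 - s) * y.
  move=> /andP[s0 s1]; have [->|s0'] := eqVneq s 0; first by lra.
  have : 0 < s by rewrite lt_neqAle eq_sym s0'.
  by nra.
apply: midpoint_concave_ge0; rewrite ?t0 ?t1//.
- apply: continuous_in_subspaceT => s; rewrite inE/= in_itv/= => s01.
  have cl (u v : R) : r * u + (1 - r) * v @[r --> (s : R)] --> s * u + (1 - s) * v.
    apply: cvgD; first by apply: cvgM; [exact: cvg_id|exact: cvg_cst].
    apply: cvgM; last exact: cvg_cst.
    by apply: cvgB; [exact: cvg_cst|exact: cvg_id].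
  apply: cvgB; last exact: cl.
  by apply: (cvg_comp _ _ (cl x y)); exact/cg/pos.
- by rewrite /phi !mul0r !subr0 !mul1r !add0r subrr.
- by rewrite /phi !subrr !mul0r !mul1r !addr0 subrr.
- move=> s u s01 u01; rewrite /phi.
  have := mid _ _ (pos s s01) (pos u u01).
  have -> : (s * x + (1 - s) * y + (u * x + (1 - u) * y)) / 2 =
     (s + u) / 2 * x + (1 - (s + u) / 2) * y by field.
  lra.
Qed.

End midpoint_concavity.

Section small_rate.
Context {R : realType}.
Variable F : cumulativeBounded (0 : R) (1 : R).
Local Open Scope ereal_scope.

Lemma exp_series_lty : \sum_(k <oo) (exp_coefficient (2 : R) k)%:E < +oo.
Proof.
rewrite [X in X < _](_ : _ = (expR 2)%:E) ?ltry//.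
rewrite expRE -EFin_lim; last first.
  rewrite /pseries/=; under eq_fun do rewrite mulrC.
  exact: is_cvg_series_exp_coeff.
apply/congr_lim/funext => n/=; rewrite /pseries/= /series/= -sumEFin//.
by apply: eq_bigr => i _; rewrite mulrC.
Qed.

Lemma shift_cst nu (a c x : R) : shift nu a (cst c%:E) x = c%:E.
Proof. by rewrite /shift integral_cst//= probability_setT mule1. Qed.

Lemma iter_mixture_le s t k x :
  iter k (mixture F s) (heaviside t) x <= ((size s)%:R ^+ k)%:E.
Proof.
have nH := nnmeasurable_heaviside t.
have sM := sigma_operator_mixture F s.
elim: k x => [|k ih] x.
  by rewrite /= /heaviside lee_fin indicE; case: (_ \in _).
have nc : nnmeasurable (cst ((size s)%:R ^+ k)%:E : R -> \bar R).
  by split=> // y; rewrite lee_fin exprn_ge0.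
apply: (@le_trans _ _ (mixture F s (cst ((size s)%:R ^+ k)%:E) x)).
  rewrite iterS; apply: (sop_le sM) => //; exact: nnmeasurable_iter.
rewrite /mixture; under eq_bigr do rewrite shift_cst.
by rewrite sumEFin big_const_seq count_predT iter_addr_0 exprS mulr_natl.
Qed.

(** Compare the terms of order 1 as lambda tends to 0: both series start with
    H_t (0) = 1, and for lambda <= 1 the terms of order k >= 2 of the right-hand
    side sum up to at most lambda^2 e^2, because M^k H_t <= 2^k for the mixture
    M of two laws. *)
Lemma mixture_le_of_exp (s s' : seq R) (t : R) : (0 <= t)%R ->
  size s' = 2%N ->
  (forall lambda, (0 < lambda)%R ->
    exp_operator lambda (mixture F s) (heaviside t) 0%R <=
    exp_operator lambda (mixture F s') (heaviside t) 0%R) ->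
  mixture F s (heaviside t) 0%R <= mixture F s' (heaviside t) 0%R.
Proof.
move=> t0 ss' le_exp.
have nH := nnmeasurable_heaviside t.
have sM := sigma_operator_mixture F.
have H1 : heaviside t 0%R = 1.
  by rewrite /heaviside indicE mem_set//= in_itv.
have term_ge0 l r k : (0 < l)%R ->
    0 <= (exp_coefficient l k)%:E * iter k (mixture F r) (heaviside t) 0%R.
  move=> l0; rewrite mule_ge0//; first by rewrite lee_fin exp_coefficient_ge0// ltW.
  by apply: nnmeasurable_ge0; exact: nnmeasurable_iter.
set M' := mixture F s' (heaviside t) 0%R.
have [C C0 CE] : exists2 C : R, (0 <= C)%R &
    \sum_(k <oo) (exp_coefficient (2 : R) k)%:E = C%:E.
  have : 0 <= \sum_(k <oo) (exp_coefficient (2 : R) k)%:E.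
    by apply: nneseries_ge0 => k _ _; rewrite lee_fin exp_coefficient_ge0.
  have := exp_series_lty; case: (\sum_(k <oo) _) => // C _ C0.
  by exists C.
suff key l : (0 < l <= 1)%R -> mixture F s (heaviside t) 0%R <= M' + (l * C)%:E.
  apply/lee_addgt0Pr => e e0.
  pose l := Num.min 1%R (e / (C + 1))%R.
  have C1 : (0 < C + 1)%R by rewrite ltr_wpDl.
  have l01 : (0 < l <= 1)%R by rewrite lt_min ltr01 divr_gt0//= ge_min lexx.
  apply: (le_trans (key l l01)); rewrite leeD2l// lee_fin.
  have : (l <= e / (C + 1))%R by rewrite ge_min lexx orbT.
  rewrite ler_pdivlMr//; have /andP[? _] := l01; nra.
move=> /andP[l0 l1].
have cexp k : exp_coefficient l k = (l ^+ k * (exp_coefficient 1 k))%R.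
  by rewrite /exp_coefficient expr1n mul1r.
have lower : 1 + l%:E * mixture F s (heaviside t) 0%R <=
    exp_operator l (mixture F s) (heaviside t) 0%R.
  apply: (le_trans _ (nneseries_lim_ge 2 _)); last by move=> k _ _; exact: term_ge0.
  rewrite big_nat_recr// big_nat1/= /exp_coefficient expr0 expr1 !divr1 mul1e H1.
  by [].
have upper : exp_operator l (mixture F s') (heaviside t) 0%R <=
    1 + l%:E * M' + (l ^+ 2 * C)%:E.
  rewrite /exp_operator (nneseries_split 0 2); last by move=> k _; exact: term_ge0.
  rewrite add0n; apply: leeD.
    rewrite big_nat_recr// big_nat1/= /exp_coefficient expr0 expr1 !divr1 mul1e H1.
    by [].
  rewrite EFinM -CE -nneseriesZl; last first.
    by move=> k _; rewrite lee_fin exp_coefficient_ge0.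
  apply: (@le_trans _ _ (\sum_(2 <= k <oo) (l ^+ 2)%:E * (exp_coefficient 2 k)%:E)).
    have tail (f : nat -> \bar R) : (forall i, 0 <= f i) ->
        \sum_(2 <= k <oo) f k = \sum_(k <oo) f (k + 2)%N.
      by move=> f0; rewrite (nneseries_addn 2 f0).
    rewrite tail; last by move=> k; exact: term_ge0.
    rewrite (tail (fun k => (l ^+ 2)%:E * _)); last first.
      by move=> k; rewrite -EFinM lee_fin mulr_ge0 ?exp_coefficient_ge0// exprn_ge0// ltW.
    apply: lee_nneseries => k _; first by move=> _; exact: term_ge0.
    apply: (@le_trans _ _ ((exp_coefficient l (k + 2))%:E * (2 ^+ (k + 2))%:E)).
      apply: lee_wpmul2l; first by rewrite lee_fin exp_coefficient_ge0// ltW.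
      by rewrite -ss'; exact: iter_mixture_le.
    rewrite -!EFinM lee_fin /exp_coefficient mulrAC -exprMn mulrA.
    rewrite exprMn ler_wpM2r ?invr_ge0 ?ler0n// ler_wpM2r ?exprn_ge0//.
    by rewrite ler_wiXn2l ?leq_addl ?(ltW l0).
  rewrite [leRHS](nneseries_split 0 2); last first.
    by move=> k _; rewrite -EFinM lee_fin mulr_ge0 ?exp_coefficient_ge0// exprn_ge0// ltW.
  rewrite add0n leeDr// sume_ge0// => k _.
  by rewrite -EFinM lee_fin mulr_ge0 ?exp_coefficient_ge0// exprn_ge0// ltW.
have finM r : exists m : R, mixture F r (heaviside t) 0%R = m%:E.
  have := iter_mixture_le r t 1 0; rewrite /= => Mle.
  have : 0 <= mixture F r (heaviside t) 0%R.
    by apply: nnmeasurable_ge0; exact: (sop_nnmeasurable (sM r)).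
  by move: Mle; case: (mixture _ _ _ _) => // m _ _; exists m.
have := le_trans lower (le_trans (le_exp l l0) upper).
rewrite /M'; have [m ->] := finM s; have [m' ->] := finM s'.
rewrite -!EFinM -!EFinD !lee_fin => h.
by rewrite -(ler_pM2l l0); lra.
Qed.

End small_rate.

Section two_copies.
Context {R : realType}.

Lemma majorized_midpoint (a b : R) : majorized
  (const_mx ((a + b) / 2) : 'rV[R]_2) (\row_(j < 2) if j == 0 then a else b).
Proof.
set m := (a + b) / 2; set theta : 'rV[R]_2 := const_mx m.
set eta : 'rV[R]_2 := \row_(j < 2) _.
have sum_theta : \sum_i theta 0 i = a + b.
  by rewrite !big_ord_recl big_ord0 !mxE /m; lra.
have sum_eta : \sum_i eta 0 i = a + b.
  by rewrite !big_ord_recl big_ord0 !mxE /=; lra.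
split; last by rewrite sum_theta sum_eta.
move=> [|[|[|]]]// _; last first.
  by rewrite !(sum_order_stat _ id) sum_theta sum_eta.
rewrite !big_ord_recl !big_ord0 !addr0 /=.
have ole (r : 'rV[R]_2) : order_stat r 0 + order_stat r 1 = \sum_i r 0 i.
  by rewrite -(sum_order_stat r id) !big_ord_recl big_ord0 addr0.
have th (i : nat) : (i < 2)%N -> order_stat theta i = m.
  move=> i2; have : order_stat theta i \in sort <=%R [seq theta 0 j | j : 'I_2].
    by rewrite mem_nth// size_sort size_map size_enum_ord.
  by rewrite mem_sort => /mapP[j _ ->]; rewrite mxE.
have := @order_stat_le R 2 eta 0 1 isT.
have := ole eta; rewrite sum_eta th// /m; lra.
Qed.

Variable F : cumulativeBounded (0 : R) (1 : R).

(** Two independent copies are the coordinates of the plane under the product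
    law; at t = 1, M_theta H_1 (0) = 2 - sum_i tail(1, theta_i). *)
Lemma scaled_tail_midpoint (a b : R) : 0 < a -> 0 < b ->
  (forall lambda : R, 0 < lambda -> forall mu : probability R R,
    compound_poisson lambda F mu -> SD mu) ->
  scaled_tail F 1 a + scaled_tail F 1 b <= 2 * scaled_tail F 1 ((a + b) / 2).
Proof.
move=> a0 b0 sd.
set m := (a + b) / 2.
have m0 : 0 < m by rewrite /m; lra.
pose theta : 'rV[R]_2 := const_mx m.
pose eta : 'rV[R]_2 := \row_(j < 2) if j == 0 then a else b.
have maj : majorized theta eta by exact: majorized_midpoint.
have th0 i : 0 <= theta 0 i by rewrite mxE ltW.
have et0 i : 0 <= eta 0 i by rewrite mxE; case: ifP => _; exact: ltW.
have : (mixture F [seq theta 0%R i | i : 'I_2] (heaviside 1) 0 <=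
        mixture F [seq eta 0%R i | i : 'I_2] (heaviside 1) 0)%E.
  apply: mixture_le_of_exp => //; first by rewrite size_map size_enum_ord.
  move=> l l0; have [mu cp] := compound_poisson_exists F l0.
  pose P : probability (R * R)%type R := (mu \x mu)%E.
  pose X1 : {RV P >-> R} := HB.pack (fst : R * R -> R)
    (isMeasurableFun.Build _ _ _ _ (fst : R * R -> R) measurable_fst).
  pose X2 : {RV P >-> R} := HB.pack (snd : R * R -> R)
    (isMeasurableFun.Build _ _ _ _ (snd : R * R -> R) measurable_snd).
  pose X (i : 'I_2) : {RV P >-> R} := if i == 0 then X1 else X2.
  have PX A B : measurable A -> measurable B -> P (A `*` B) = (mu A * mu B)%E.
    by move=> mA mB; exact: product_measure1E.
  have lawX1 A : measurable A -> P (X1 @^-1` A) = mu A.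
    move=> mA; transitivity (P (A `*` setT)).
      by congr (P _); apply/seteqP; split => // w [].
    by rewrite PX// probability_setT mule1.
  have lawX2 A : measurable A -> P (X2 @^-1` A) = mu A.
    move=> mA; transitivity (P (setT `*` A)).
      by congr (P _); apply/seteqP; split => // w [].
    by rewrite PX// probability_setT mul1e.
  have lawX i : has_law (X i) mu.
    by move=> A mA; rewrite /X /distribution /pushforward; case: ifP => _;
      [exact: lawX1|exact: lawX2].
  have indX : mutually_independent X.
    move=> J A mA.
    pose A' i := if i \in J then A i else setT.
    have mA' i : measurable (A' i) by rewrite /A'; case: ifP.
    transitivity (P (A' 0 `*` A' 1)).
      congr (P _); apply/seteqP; split => w.
        move=> h; split; rewrite /A'; case: ifPn => // iJ.
          by have := h 0 iJ; rewrite /X.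
        by have := h 1 iJ; rewrite /X.
      move=> [w0 w1] i /= iJ; rewrite /X.
      case: (i =P 0) => [i0|/eqP i0].
        by move: w0; rewrite /A' -i0 iJ.
      have i1 : i = 1 by apply/val_inj; case: i i0 {iJ} => [[|[|]]].
      by move: w1; rewrite /A' -i1 iJ.
    rewrite PX//.
    transitivity (\prod_(i < 2) mu (A' i))%E.
      by rewrite !big_ord_recl big_ord0 mule1; congr (mu _ * mu (A' _))%E; exact: val_inj.
    transitivity (\prod_(i < 2 | i \in J) mu (A i))%E.
      rewrite [RHS]big_mkcond/=; apply: eq_bigr => i _; rewrite /A'.
      by case: ifP => // _; exact: probability_setT.
    transitivity (\prod_(i <- J) mu (A i))%E; last first.
      by apply: eq_bigr => i _; exact/esym/lawX.
    rewrite -big_filter; apply: perm_big; apply: uniq_perm.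
    - by rewrite filter_uniq// index_enum_uniq.
    - exact: fset_uniq.
    - by move=> i; rewrite mem_filter mem_index_enum andbT.
  have := sd l l0 mu cp 2%N isT _ _ P X lawX indX theta eta th0 et0 maj 1.
  rewrite !(cdf_weighted_sum _ _ l0 cp lawX indX).
  by rewrite lee_pmul2l ?lte_fin ?exprn_gt0 ?expR_gt0.
rewrite !mixture_heaviside// lee_fin subr0 lerD2l lerN2.
rewrite !big_ord_recl !big_ord0 !mxE /= !addr0.
by rewrite mulr_natl mulr2n.
Qed.

End two_copies.

Section main.
Context {R : realType}.
Variable F : cumulativeBounded (0 : R) (1 : R).

Lemma inverted_concave_of_SD : continuous (F : R -> R) ->
  df_ess_inf F = 0%E ->
  (forall lambda : R, 0 < lambda -> forall mu : probability R R,
    compound_poisson lambda F mu -> SD mu) ->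
  inverted_concave F.
Proof.
move=> Fc Finf sd; split => //; apply: midpoint_concave.
- move=> x x0; apply: cvgB; first exact: cvg_cst.
  apply: (cvg_comp (fun x : R => x^-1) F); last exact: Fc.
  by apply: cvgV; [rewrite gt_eqF|exact: cvg_id].
- move=> x y x0 y0; have := scaled_tail_midpoint x0 y0 sd.
  by rewrite /scaled_tail !gt_eqF ?divr_gt0 ?addr_gt0// !div1r.
Qed.

End main.

Theorem theorem3 (R : realType) (F : cumulativeBounded (0 : R) (1 : R)) :
  continuous (F : R -> R) -> df_ess_inf F = 0%E ->
  (forall lambda : R, 0 < lambda ->
     forall mu : probability R R,
       compound_poisson lambda F mu -> SD mu) <->
  inverted_concave F.
Proof.
move=> Fc Finf; split; first exact: inverted_concave_of_SD.
by move=> Fic lambda l0 mu; exact: SD_of_inverted_concave.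
Qed.
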